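(* Let $g:(0,\infty)\to(0,\infty)$ be a function that converges monotonically to zero, and assume that one of the following holds: (a) $g$ varies regularly at infinity with index strictly less than $-2$; or (b') the function $u\mapsto u^2g(u)$ converges monotonically to zero as $u\to\infty$. If $$\lim_{u\to\infty}\frac{\Lambda_g(u)}{\log\log u}=0,$$ then $\mathbb P$-almost surely $\limsup_{n\to\infty}\lambda_1^{(n)}/g(n)=\infty$.
   Context: Let $d\ge 2$. Let $\mathfrak E_d=\{\{x,y\}: x,y\in\mathbb Z^d,\ |x-y|_1=1\}$; write $x\sim y$ if $\{x,y\}\in\mathfrak E_d$. The environment $\boldsymbol w=(w_e)_{e\in\mathfrak E_d}$ is a family of i.i.d. $(0,\infty)$-valued random variables with law $\mathbb P$; $w$ denotes a generic copy. Let $B_n=[-n,n]^d\cap\mathbb Z^d$. For real-valued $f\in\ell^2(\mathbb Z^d)$, $\mathcal E^{\boldsymbol w}(f)=\frac12\sum_{x}\sum_{y\sim x}w_{xy}(f(x)-f(y))^2$ (the Dirichlet form of $(\mathcal L_{\boldsymbol w}f)(x)=\sum_{y\sim x}w_{xy}(f(y)-f(x))$). The principal Dirichlet eigenvalue in $B_n$ is $\lambda_1^{(n)}=\inf\{\mathcal E^{\boldsymbol w}(f): \mathrm{supp}\,f\subseteq B_n,\ \|f\|_2=1\}$. For $g:(0,\infty)\to(0,\infty)$, $\Lambda_g(u)=u^d\,\mathbb P[w\le g(u)]^{2d}$. A function varies regularly at infinity with index $\rho$ if it equals $u^\rho L(u)$ with $L(Cu)/L(u)\to1$ as $u\to\infty$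 for all $C>0$. *)

(* Defs.v *)
From HB Require Import structures.
From mathcomp Require Import all_boot all_order all_algebra.
From mathcomp Require Import all_classical all_reals all_analysis.
Set Implicit Arguments. Unset Strict Implicit. Unset Printing Implicit Defensive.
Import Order.TTheory GRing.Theory Num.Theory numFieldNormedType.Exports.
Local Open Scope classical_set_scope.
Local Open Scope ring_scope.

Definition pt (d : nat) := 'rV[int]_d.

Definition ev (d : nat) (i : 'I_d) : pt d := delta_mx 0 i.

(* Nearest-neighbour edges of Z^d are indexed by (x, i) : pt d * 'I_d,      *)
(* standing for the unordered edge {x, x + e_i}; this is a bijection onto   *)
(* the edge set E_d.                                                        *)
Definition edge (d : nat) := (pt d * 'I_d)%type.

Definition inbox (d n : nat) (x : pt d) : Prop := forall j, `|x 0 j| <= n%:Z.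
Definition boxpt (d n : nat) (k : {ffun 'I_d -> 'I_(2 * n + 1)}) : pt d :=
  \row_j ((k j : nat)%:Z - n%:Z).

Section Env.
Variables (R : realType) (d : nat).

Definition cond (W : edge d -> R) (x y : pt d) : R :=
  if [pick i | y == x + ev i] is Some i then W (x, i) else
  if [pick i | x == y + ev i] is Some i then W (y, i) else 0.

(* Dirichlet form E^w(f) = 1/2 sum_x sum_{y~x} w_xy (f x - f y)^2, for f    *)
(* supported in B_n.  For such f every nonzero term has x in B_{n+1}, so    *)
(* the (a priori infinite) outer sum is written over x in B_{n+1}; the      *)
(* inner sum runs over the 2d neighbours x + e_i and x - e_i.               *)
Definition dirichlet (W : edge d -> R) (n : nat) (f : pt d -> R) : R :=
  2^-1 * \sum_(k : {ffun 'I_d -> 'I_(2 * n.+1 + 1)})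
    \sum_(i < d) \sum_(b : bool)
      (let x := boxpt k in
       let y := if b then x + ev i else x - ev i in
       cond W x y * (f x - f y) ^+ 2).

Definition lambda1 (W : edge d -> R) (n : nat) : R :=
  inf [set dirichlet W n f | f in
        [set f : pt d -> R | (forall x, ~ inbox n x -> f x = 0) /\
           \sum_(k : {ffun 'I_d -> 'I_(2 * n + 1)}) f (boxpt k) ^+ 2 = 1]].

Definition reg_var (g : R -> R) (rho : R) : Prop :=
  let L := fun u => g u * powR u (- rho) in
  forall C : R, 0 < C -> (L (C * u) / L u) @[u --> +oo] --> (1 : R).

Definition mono_to_zero (g : R -> R) : Prop :=
  (forall u v, 0 < u -> u <= v -> g v <= g u) /\ g u @[u --> +oo] --> (0 : R).

End Env.

Definition iid_env (R : realType) (dd : measure_display) (T : measurableType dd)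
    (P : probability T R) (d : nat) (w : edge d -> T -> R) : Prop :=
  [/\ (forall e, measurable_fun setT (w e)),
      (forall e om, 0 < w e om),
      (forall e e' (B : set R), measurable B ->
          P (w e @^-1` B) = P (w e' @^-1` B)) &
      (forall (s : seq (edge d)) (B : edge d -> set R), uniq s ->
          (forall e, measurable (B e)) ->
          P (\bigcap_(e in [set e | e \in s]) (w e @^-1` B e)) =
          (\prod_(e <- s) P (w e @^-1` B e))%E)].

(* Lambda_g(u) = u^d P[w <= g(u)]^{2d}, w a generic copy (edge (0, e_0)) *)
Definition Lambda (R : realType) (dd : measure_display) (T : measurableType dd)
    (P : probability T R) (d : nat) (w : edge d -> T -> R) (i0 : 'I_d)
    (g : R -> R) (u : R) : R :=
  u ^+ d * fine (P [set om | w (0, i0) om <= g u]) ^+ (2 * d).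

(* Main.v *)
Require Import Defs.
From HB Require Import structures.
From mathcomp Require Import all_boot all_order all_algebra.
From mathcomp Require Import all_classical all_reals all_analysis.
From mathcomp Require Import zify ring lra.
Set Implicit Arguments. Unset Strict Implicit. Unset Printing Implicit Defensive.
Import Order.TTheory GRing.Theory Num.Theory numFieldNormedType.Exports.
Local Open Scope classical_set_scope.
Local Open Scope ring_scope.

(** Fix [C] large and call an edge slow if its conductance is at most [C g(n)].
    Since [u^2 g(u)] is (almost) decreasing, [C g(n) <= g(n / A)] for a constant
    [A], hence [n^d P(slow)^(2d) = o(log log n)].  Consequently a vertex all of
    whose edges are slow is the only obstruction: along [n_k = 2^(4 k^2)], almost
    surely eventually no ball of fixed radius contains [2d + 1] slow edges, while
    by Harris' inequality the annulus [B_(n_k) \ B_(n_(k-1) + 1)] contains no such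
    trapped vertex with probability at least [1 / k], independently in [k], so
    this happens infinitely often.

    At such a scale every vertex reaches, by boundedly many fast edges, a nearby
    "hub", a vertex lying only on coordinate slices of a ball without slow edges.
    Neighbouring hubs are joined by edges of conductance at least [g(2^j)], where
    [j] is the first level at which the ball has few edges of conductance at most
    [g(2^j)].  An exponential Markov inequality along lines shows that these
    levels are so rarely large that telescoping along lines gives
    [|f|^2 <= (K / (C g(n)) + o(1 / g(n))) E(f)], i.e.
    [lambda_1 >= (C / K') g(n)]. *)

Section FiniteSums.
Variable R : realDomainType.

Lemma ler_sum_count_mem (T : eqType) (s l : seq T) (k : nat) (h : T -> R) :
  (forall v, 0 <= h v) -> (forall v, v \notin l -> h v = 0) -> uniq l ->
  (forall v, (count_mem v s <= k)%N) ->
  \sum_(v <- s) h v <= k%:R * \sum_(v <- l) h v.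
Proof.
move=> h0 hl ul sk.
have hE v : h v = \sum_(x <- l) (v == x)%:R * h x.
  have [vl|vl] := boolP (v \in l).
    rewrite (bigD1_seq v)//= eqxx mul1r big1 ?addr0// => x.
    by rewrite eq_sym => /negbTE ->; rewrite mul0r.
  rewrite hl// big_seq big1// => x xl; case: eqP => [vx|_]; last by rewrite mul0r.
  by rewrite vx xl in vl.
rewrite (eq_bigr _ (fun v _ => hE v)) exchange_big mulr_sumr ler_sum// => x _.
rewrite -mulr_suml ler_wpM2r// -natr_sum ler_nat (leq_trans _ (sk x))//.
by rewrite -sum1_count [leqRHS]big_mkcond leq_sum// => v _; case: eqP.
Qed.

Lemma sum_cauchy_schwarz (I : Type) (s : seq I) (a b : I -> R) :
  (\sum_(i <- s) a i * b i) ^+ 2 <=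
  (\sum_(i <- s) a i ^+ 2) * (\sum_(i <- s) b i ^+ 2).
Proof.
suff : 0 <= \sum_(i <- s) \sum_(j <- s) (a i * b j - a j * b i) ^+ 2.
  have -> : \sum_(i <- s) \sum_(j <- s) (a i * b j - a j * b i) ^+ 2 =
      \sum_(i <- s) (a i ^+ 2 * (\sum_(j <- s) b j ^+ 2) +
        (\sum_(j <- s) a j ^+ 2) * b i ^+ 2 -
        2 * (a i * b i * \sum_(j <- s) a j * b j)).
    apply: eq_bigr => i _.
    rewrite mulr_sumr mulr_suml [in RHS]mulr_sumr mulr_sumr -sumrN -!big_split/=.
    by apply: eq_bigr => j _; ring.
  rewrite sumrB big_split/= -mulr_suml -!mulr_sumr -mulr_suml.
  by move: (\sum_(i <- s) a i * b i) (\sum_(i <- s) a i ^+ 2) => x y; nra.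
by apply: sumr_ge0 => i _; apply: sumr_ge0 => j _; exact: sqr_ge0.
Qed.

Lemma dist_telescope_le (u t : nat -> R) (a b : nat) : (a <= b)%N ->
  (forall l, (a <= l < b)%N -> `|u l - u l.+1| <= t l) ->
  `|u a - u b| <= \sum_(a <= l < b) t l.
Proof.
move=> ab ut; rewrite distrC -telescope_sumr// (le_trans (ler_norm_sum _ _ _))//.
by rewrite !big_nat ler_sum// => l lb; rewrite distrC ut.
Qed.

Lemma ler_sum_nat_sub (F : nat -> R) (a b a' b' : nat) : (forall k, 0 <= F k) ->
  (a' <= a)%N -> (b <= b')%N -> \sum_(a <= k < b) F k <= \sum_(a' <= k < b') F k.
Proof.
move=> F0 aa bb; have [ba|/ltnW ab] := leqP b a; first by rewrite big_geq// sumr_ge0.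
rewrite [leRHS](big_cat_nat (n := a))//=; last exact: leq_trans bb.
rewrite [X in _ <= _ + X](big_cat_nat (n := b))//=.
by rewrite ler_wpDl ?sumr_ge0// ler_wpDr ?sumr_ge0.
Qed.

Lemma sqrD_le (x y : R) : (x + y) ^+ 2 <= 2 * x ^+ 2 + 2 * y ^+ 2.
Proof. by have := sqr_ge0 (x - y); rewrite !expr2; nra. Qed.

End FiniteSums.

(** * Boxes, stars and balls of the lattice *)

Section Lattice.
Variable d : nat.
Implicit Types (x y u v : pt d) (i j : 'I_d) (c : int) (e : edge d).

Lemma inboxB (n : nat) u v : inbox n (u - v) <-> forall j, `|u 0 j - v 0 j| <= n%:Z.
Proof. by split=> + j => /(_ j); rewrite !mxE. Qed.

Lemma ptD u v j : (u + v) 0 j = u 0%R j + v 0%R j.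
Proof. by rewrite mxE. Qed.

Lemma inboxD (m n : nat) u v : inbox m u -> inbox n v -> inbox (m + n) (u + v).
Proof. by move=> um vn j; have := um j; have := vn j; rewrite ptD; lia. Qed.

Lemma inboxW (m n : nat) u : (m <= n)%N -> inbox m u -> inbox n u.
Proof. by move=> mn um j; have := um j; lia. Qed.

Definition box (n : nat) : seq (pt d) :=
  [seq boxpt k | k : {ffun 'I_d -> 'I_(2 * n + 1)}].

Lemma boxpt_inj (n : nat) : injective (@boxpt d n).
Proof.
move=> k k' /rowP kk'; apply/ffunP => j; apply/val_inj => /=.
by have := kk' j; rewrite !mxE; lia.
Qed.

Lemma inbox_boxpt (n : nat) (k : {ffun 'I_d -> 'I_(2 * n + 1)}) : inbox n (boxpt k).
Proof. by move=> j; rewrite mxE; have := ltn_ord (k j); lia. Qed.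

Lemma boxP (n : nat) x : reflect (inbox n x) (x \in box n).
Proof.
apply: (iffP codomP) => [[k ->]|xn]; first exact: inbox_boxpt.
have lt_side j : (absz (x 0%R j + n%:Z)%R < 2 * n + 1)%N by have := xn j; lia.
exists [ffun j => Ordinal (lt_side j)]; apply/rowP => j.
by rewrite mxE ffunE /=; have := xn j; lia.
Qed.

Lemma uniq_box (n : nat) : uniq (box n).
Proof. by rewrite map_inj_uniq ?enum_uniq//; exact: boxpt_inj. Qed.

Lemma size_box (n : nat) : size (box n) = ((2 * n + 1) ^ d)%N.
Proof. by rewrite size_image card_ffun !card_ord. Qed.

Lemma big_box (R : nmodType) (n : nat) (h : pt d -> R) :
  \sum_(k : {ffun 'I_d -> 'I_(2 * n + 1)}) h (boxpt k) = \sum_(x <- box n) h x.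
Proof. by rewrite big_image. Qed.

Lemma ev_coord i j : (ev i : pt d) 0 j = (j == i)%:Z.
Proof. by rewrite mxE eqxx; case: eqP. Qed.

Lemma evD_coord x i j : (x + ev i) 0 j = x 0 j + (j == i)%:Z.
Proof. by rewrite ptD ev_coord. Qed.

Lemma ev_inj : injective (@ev d).
Proof.
move=> i j ij; apply/eqP; have : (ev i : pt d) 0 i = (ev j : pt d) 0 i by rewrite ij.
by rewrite !ev_coord eqxx; case: eqP.
Qed.

Definition star x : seq (edge d) :=
  [seq (x, i) | i <- enum 'I_d] ++ [seq (x - ev i, i) | i <- enum 'I_d].

Lemma mem_star x e : (e \in star x) = (e.1 == x) || (x == e.1 + ev e.2).
Proof.
case: e => y i; rewrite mem_cat /=; congr (_ || _); apply/mapP/eqP.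
- by case=> j _ [].
- by move=> ->; exists i; rewrite ?mem_enum.
- by case=> j _ [-> ->]; rewrite subrK.
- by move=> ->; exists i; rewrite ?mem_enum ?addrK.
Qed.

Lemma size_star x : size (star x) = (2 * d)%N.
Proof.
rewrite size_cat [X in (X + _)%N]size_map [X in (_ + X)%N]size_map.
by rewrite size_enum_ord mul2n addnn.
Qed.

Lemma uniq_star x : uniq (star x).
Proof.
rewrite cat_uniq; apply/and3P; split; try by rewrite map_inj_uniq ?enum_uniq// => i j [].
apply/hasPn => _ /mapP[i _ ->]; apply/mapP => -[j _ [/rowP/(_ i) + _]].
by rewrite !mxE !eqxx /=; lia.
Qed.

Lemma star_close x e j : e \in star x -> 0 <= x 0 j - e.1 0 j <= 1.
Proof.
by rewrite mem_star => /orP[/eqP ->|/eqP ->]; rewrite ?evD_coord; [lia|case: eqP => _; lia].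
Qed.

Definition trapped (beta : pred (edge d)) x : bool := all beta (star x).

Definition ball_edges (r : nat) y : seq (edge d) :=
  [seq (y + x, i) | x <- box r, i <- enum 'I_d].

Lemma ball_edgesP (r : nat) y e : reflect (inbox r (e.1 - y)) (e \in ball_edges r y).
Proof.
case: e => v i; apply: (iffP allpairsP) => /= [[[x j] /= [/boxP xr _ [-> _]]]|vr].
  by rewrite addrC addKr.
by exists (v - y, i); split; rewrite ?mem_enum//=; [apply/boxP|rewrite addrC subrK].
Qed.

Lemma uniq_ball_edges (r : nat) y : uniq (ball_edges r y).
Proof.
apply: allpairs_uniq; rewrite ?uniq_box ?enum_uniq// => -[x i] [x' i'] _ _.
by move=> /= [/addrI -> ->].
Qed.

Lemma size_ball_edges (r : nat) y : size (ball_edges r y) = ((2 * r + 1) ^ d * d)%N.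
Proof. by rewrite size_allpairs size_box size_enum_ord. Qed.

Lemma star_sub_ball_edges (n : nat) x : inbox n x -> {subset star x <= ball_edges n.+1 0}.
Proof.
move=> xn e ex; apply/ball_edgesP/inboxB => j; rewrite mxE.
by have := xn j; have := star_close j ex; lia.
Qed.

Lemma ball_edges_sub_box (n r : nat) y :
  inbox n y -> {subset ball_edges r y <= ball_edges (n + r) 0}.
Proof.
move=> yn e /ball_edgesP er; apply/ball_edgesP.
by rewrite subr0 -[e.1](subrK y) addrC; exact: inboxD.
Qed.

Definition nbad (r : nat) (beta : pred (edge d)) y : nat := count beta (ball_edges r y).

Definition set_coord u i c : pt d := \row_j (if j == i then c else u 0 j).

Lemma set_coordE u i c j : set_coord u i c 0 j = if j == i then c else u 0 j.
Proof. by rewrite mxE. Qed.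

Lemma set_coord_id u i : set_coord u i (u 0 i) = u.
Proof. by apply/rowP => j; rewrite mxE; case: eqP => [->|]. Qed.

Lemma set_coordK u i c c' : set_coord (set_coord u i c) i c' = set_coord u i c'.
Proof. by apply/rowP => j; rewrite !mxE; case: eqP. Qed.

Lemma inbox_set_coord (n : nat) u i c : inbox n u -> `|c| <= n%:Z -> inbox n (set_coord u i c).
Proof. by move=> un cn j; rewrite mxE; case: ifP. Qed.

(* The line through x in direction i, cut to the slab |x_i| <= n and indexed *)
(* by 0 <= k <= 2n.                                                          *)
Definition line_pt (n : nat) x i (k : nat) : pt d := set_coord x i (k%:Z - n%:Z).

Lemma inbox_line_pt (n : nat) x i (k : nat) : inbox n x -> (k < 2 * n + 1)%N ->
  inbox n (line_pt n x i k).
Proof. by move=> xn kn; apply: inbox_set_coord => //; lia. Qed.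

End Lattice.
Arguments box {d}.
Arguments ball_edges {d}.
Arguments nbad {d}.
Arguments line_pt {d}.

(** * A Poincare inequality in the presence of few bad edges *)

Section Gradient.
Variables (R : realDomainType) (d : nat).
Implicit Types (f : pt d -> R) (x y u v : pt d) (i j : 'I_d) (e : edge d).
Implicit Types (beta : pred (edge d)) (tau : R).

Definition grad f e : R := f e.1 - f (e.1 + ev e.2).

Lemma dist_segment_le f tau u i (c : int) :
  (forall v, (forall j, j != i -> v 0 j = u 0 j) ->
     Num.min (u 0 i) c <= v 0 i < Num.max (u 0 i) c -> `|grad f (v, i)| <= tau) ->
  `|f u - f (set_coord u i c)| <= (absz (u 0 i - c)%R)%:R * tau.
Proof.
wlog uc : u c / u 0 i <= c.
  move=> upward steps; have [|/ltW cu] := leP (u 0 i) c; first by move/upward; apply.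
  have := upward (set_coord u i c) (u 0 i); rewrite set_coordK set_coord_id set_coordE eqxx.
  rewrite distnC distrC; apply=> // v vu vi; apply: steps; last by lia.
  by move=> j ji; rewrite vu// set_coordE (negbTE ji).
move=> steps; pose k := absz (c - u 0 i)%R.
have -> : absz (u 0 i - c)%R = k by rewrite distnC.
have -> : set_coord u i c = u + ev i *+ k.
  apply/rowP => j; rewrite !mxE mulmxnE !mxE eqxx/=.
  by case: (eqVneq j i) => [->|_] /=; rewrite ?mul0rn ?addr0 // /k; lia.
have -> : k%:R * tau = \sum_(0 <= l < k) tau by rewrite sumr_const_nat subn0 mulr_natl.
rewrite -[X in f X - _]addr0 -(mulr0n (ev i)).
apply: (dist_telescope_le (u := fun l => f (u + ev i *+ l))) => // l /andP[_ lk].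
rewrite mulrSr addrA; apply: (steps (u + ev i *+ l)) => [j ji|]; rewrite !mxE mulmxnE !mxE !eqxx/=.
  by rewrite (negbTE ji) mul0rn addr0.
by move: lk; rewrite /k; lia.
Qed.

Definition grad_le_off (r : nat) beta y f tau : Prop :=
  forall e, e \in ball_edges r y -> ~~ beta e -> `|grad f e| <= tau.

Definition bad_coords (r : nat) beta y i : seq int :=
  [seq e.1 0 i | e : edge d <- ball_edges r y & beta e].

Lemma size_bad_coords r beta y i : size (bad_coords r beta y i) = nbad r beta y.
Proof. by rewrite size_map size_filter. Qed.

Lemma bad_coords_mem r beta y i e :
  e \in ball_edges r y -> beta e -> e.1 0 i \in bad_coords r beta y i.
Proof. by move=> er be; apply/mapP; exists e; rewrite ?mem_filter ?be. Qed.

Definition hub (r : nat) beta y x : Prop :=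
  inbox r (x - y) /\ forall i, x 0 i \notin bad_coords r beta y i.

Lemma hub_sub r beta beta' y x : subpred beta beta' -> hub r beta' y x -> hub r beta y x.
Proof.
move=> sub [xr xc]; split=> // i; apply: contra (xc i) => /mapP[e + ->].
by rewrite mem_filter => /andP[/sub be er]; exact: bad_coords_mem.
Qed.

Lemma exists_notin_segment (s : seq int) (a : int) (n : nat) : (size s < n)%N ->
  exists c, [/\ a <= c, c < a + n%:Z & c \notin s].
Proof.
move=> sn; apply: contrapT => all_in.
have sub : {subset [seq a + l%:Z | l <- iota 0 n] <= s}.
  move=> c /mapP[l]; rewrite mem_iota add0n => /andP[_ ln] ->.
  by apply: contrapT => /negP cs; apply: all_in; exists (a + l%:Z); split=> //; lia.
have un : uniq [seq a + l%:Z | l <- iota 0 n].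
  by rewrite map_inj_uniq ?iota_uniq// => l l'; lia.
by have := uniq_leq_size un sub; rewrite size_map size_iota leqNgt sn.
Qed.

Lemma exists_hub r beta y : (nbad r beta y < r)%N -> exists x, hub r beta y x.
Proof.
move=> nr; have /choice[c cP] i : exists c, [/\ y 0 i <= c, c < y 0 i + r%:Z &
    c \notin bad_coords r beta y i].
  by apply: exists_notin_segment; rewrite size_bad_coords.
exists (\row_i c i); split=> [|i]; last by rewrite mxE; case: (cP i).
by apply/inboxB => j; rewrite mxE; case: (cP j); lia.
Qed.

Lemma dist_endpoints_le f e u u' : e \in star u -> e \in star u' ->
  `|f u - f u'| <= `|grad f e|.
Proof.
rewrite !mem_star /grad => /orP[/eqP <-|/eqP ->] /orP[/eqP <-|/eqP ->] //.
- by rewrite subrr normr0.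
- by rewrite distrC.
- by rewrite subrr normr0.
Qed.

(* The two endpoints of an edge emit 4d - 2 > 2d edge-disjoint rays in the   *)
(* coordinate directions, hence one of them contains no bad edge.            *)
Lemma exists_free_ray r beta y e : (2 <= d)%N -> (nbad r beta y <= 2 * d)%N ->
  exists p j (s : bool), e \in star p /\
    forall v, (v, j) \in ball_edges r y -> (forall l, l != j -> v 0 l = p 0 l) ->
      (p 0 j <= v 0 j) = s -> ~~ beta (v, j).
Proof.
case: e => b a d_ge2 few_bad.
pose ray_of (e : edge d) := (e.2, b 0 e.2 <= e.1 0 e.2, b 0 a < e.1 0 a).
pose rays := [set: 'I_d * bool * bool] :\: [set (a, true, false); (a, false, true)].
pose hit := [set x in [seq ray_of e | e <- ball_edges r y & beta e]]%SET.
have card_hit : (#|hit| <= 2 * d)%N.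
  by rewrite cardsE (leq_trans (card_size _))// size_map size_filter.
have card_rays : (2 * d < #|rays|)%N.
  rewrite cardsD cardsT !card_prod card_ord !card_bool finset.setTI cards2.
  by case: eqP => //= _; lia.
have [[[j s] o] + free] : exists2 x, x \in rays & x \notin hit.
  apply/subsetPn; apply: contraTN card_rays => /subset_leq_card sub.
  by rewrite -leqNgt (leq_trans sub).
rewrite !inE andbT negb_or => /andP[not_in not_out].
have so : j = a -> s = o.
  by move=> ja; move: not_in not_out; rewrite ja !xpair_eqE eqxx; case: s {free}; case: o.
pose p := if o then b + ev a else b.
have pE l : p 0 l = b 0 l + (o && (l == a))%:Z.
  by rewrite /p; case: (o); rewrite ?evD_coord ?addr0.
exists p, j, s; split; first by rewrite mem_star /p/=; case: (o); rewrite eqxx ?orbT.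
move=> v vr vp vj; apply: contra free => bv; rewrite inE; apply/mapP; exists (v, j).
  by rewrite mem_filter bv.
congr (_, _, _) => /=.
  rewrite -vj pE; have [ja|] := eqVneq j a; last by rewrite andbF addr0.
  by move: vj; rewrite pE ja eqxx andbT so//; case: (o); lia.
have [aj|aj] := eqVneq a j.
  by move: vj; rewrite pE -aj eqxx andbT so//; case: (o) => /=; lia.
by rewrite vp// pE eqxx andbT; case: (o); lia.
Qed.

Definition hub_diam (r : nat) : nat := 2 * (d * (2 * r)).

Definition attach_diam (r : nat) : nat := 1 + (2 * d + 1) + hub_diam r.

Section OneBall.
Variables (r : nat) (beta : pred (edge d)) (y : pt d) (f : pt d -> R) (tau : R).
Hypothesis tau_ge0 : 0 <= tau.
Hypothesis f_grad : grad_le_off r beta y f tau.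

(* Change the coordinates one at a time: every edge crossed lies in the slice. *)
Lemma dist_slice_le u u' i : inbox r (u - y) -> inbox r (u' - y) ->
  u 0 i = u' 0 i -> u 0 i \notin bad_coords r beta y i ->
  `|f u - f u'| <= (d * (2 * r))%:R * tau.
Proof.
move=> /inboxB ur /inboxB u'r uu' clean.
pose mix (l : nat) : pt d := \row_j (if (j < l)%N then u' 0 j else u 0 j).
have mix0 : mix 0%N = u by apply/rowP => j; rewrite mxE.
have mixd : mix d = u' by apply/rowP => j; rewrite mxE ltn_ord.
have -> : (d * (2 * r))%:R * tau = \sum_(0 <= l < d) (2 * r)%:R * tau.
  by rewrite sumr_const_nat subn0 natrM -mulrA mulr_natl.
rewrite -{1}mix0 -mixd; apply: (dist_telescope_le (u := f \o mix)) => // l /andP[_ ld] /=.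
have mixr : inbox r (mix l - y) by apply/inboxB => j; rewrite mxE; case: ifP.
have mixi : mix l 0 i = u 0 i by rewrite mxE; case: ifP.
pose j := Ordinal ld.
have -> : mix l.+1 = set_coord (mix l) j (u' 0 j).
  apply/rowP => j'; rewrite !mxE; case: (eqVneq j' j) => [->|]; first by rewrite leqnn.
  by rewrite -val_eqE/= ltnS leq_eqVlt => /negbTE ->.
have [->|ji] := eqVneq j i.
  by rewrite -uu' -mixi set_coord_id subrr normr0 mulr_ge0.
move: (mix l) mixi mixr => q qi /inboxB qr.
have qj := qr j; have u'j := u'r j.
rewrite (le_trans (@dist_segment_le f tau q j (u' 0 j) _))//; last first.
  by rewrite ler_wpM2r// ler_nat; lia.
move=> v vq vb.
have vr : (v, j) \in ball_edges r y.
  apply/ball_edgesP/inboxB => j' /=; have [->|j'j] := eqVneq j' j; first by lia.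
  by rewrite vq.
apply: f_grad => //; apply: contra clean => bv.
by rewrite -qi -vq 1?eq_sym//; exact: (@bad_coords_mem r beta y i (v, j)).
Qed.

Hypothesis d_ge2 : (2 <= d)%N.

Lemma dist_hub_le x u i : hub r beta y x -> inbox r (u - y) ->
  u 0 i \notin bad_coords r beta y i -> `|f u - f x| <= (hub_diam r)%:R * tau.
Proof.
move=> [xr x_clean] ur u_clean.
have [j ji] : exists j : 'I_d, j != i.
  have [->|] := eqVneq i (Ordinal d_ge2); last by exists (Ordinal d_ge2); rewrite eq_sym.
  by exists (Ordinal (ltnW d_ge2)).
pose v := set_coord x i (u 0 i).
have vr : inbox r (v - y).
  apply/inboxB => l; rewrite set_coordE; case: eqP => [->|_]; first by move/inboxB: ur; exact.
  by move/inboxB: xr; exact.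
have uv : `|f u - f v| <= (d * (2 * r))%:R * tau.
  by apply: (@dist_slice_le u v i) => //; rewrite set_coordE eqxx.
have vx : `|f v - f x| <= (d * (2 * r))%:R * tau.
  by apply: (@dist_slice_le v x j) => //; rewrite set_coordE (negbTE ji).
rewrite (le_trans (ler_distD (f v) _ _))//.
by rewrite /hub_diam natrM -mulrA [2 * _]mulr_natl mulr2n lerD.
Qed.

Lemma dist_hub_attached_le x e : (2 * d + 2 <= r)%N -> (nbad r beta y <= 2 * d)%N ->
  hub r beta y x -> e \in star y -> ~~ beta e ->
  `|f y - f x| <= (attach_diam r)%:R * tau.
Proof.
move=> dr few_bad hub_x ey good_e.
have [p [j [s [ep free]]]] := exists_free_ray e d_ge2 few_bad.
have py l : `|p 0 l - y 0 l| <= 1.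
  by have := star_close l ep; have := star_close l ey; lia.
have size_bad : (size (bad_coords r beta y j) < 2 * d + 1)%N by rewrite size_bad_coords addn1.
have [c [pc cp c_clean]] := exists_notin_segment
  (if s then p 0 j else p 0 j - (2 * d + 1)%N%:Z) size_bad.
pose q := set_coord p j c.
have cy : `|c - y 0 j| <= r%:Z by have := py j; case: (s) pc cp; lia.
have qr : inbox r (q - y).
  apply/inboxB => l; rewrite set_coordE; case: eqP => [->//|_].
  by have := py l; lia.
have yp : `|f y - f p| <= tau.
  apply: le_trans (dist_endpoints_le f ey ep) (f_grad _ good_e).
  by apply/ball_edgesP/inboxB => l; have := star_close l ey; lia.
have pq : `|f p - f q| <= (2 * d + 1)%:R * tau.
  apply: (le_trans (@dist_segment_le f tau _ _ _ _)); last first.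
    by rewrite ler_wpM2r// ler_nat; case: (s) pc cp; lia.
  move=> v vl vj.
  have vr : (v, j) \in ball_edges r y.
    apply/ball_edgesP/inboxB => l /=; have [->|lj] := eqVneq l j; first by have := py j; lia.
    by rewrite vl//; have := py l; lia.
  by apply: f_grad => //; apply: free => //; case: (s) pc cp; lia.
have qx : `|f q - f x| <= (hub_diam r)%:R * tau.
  by apply: (@dist_hub_le x q j) => //; rewrite /q set_coordE eqxx.
rewrite (le_trans (ler_distD (f q) _ _))// natrD mulrDl lerD//.
by rewrite (le_trans (ler_distD (f p) _ _))// natrD mulrDl mul1r lerD.
Qed.

End OneBall.

(* Neighbouring hubs are compared through a point all of whose coordinates  *)
(* are clean for both balls.                                                *)
Lemma dist_neighbor_hubs_le r beta beta' y y' f tau tau' x x' :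
  (2 <= d)%N -> 0 <= tau -> 0 <= tau' ->
  grad_le_off r beta y f tau -> grad_le_off r beta' y' f tau' ->
  inbox 1 (y - y') -> (nbad r beta y + nbad r beta' y' < r)%N ->
  hub r beta y x -> hub r beta' y' x' ->
  `|f x - f x'| <= (hub_diam r)%:R * (tau + tau').
Proof.
move=> d2 tau0 tau0' f_grad f_grad' /inboxB yy few_bad hub_x hub_x'.
have /choice[c cP] i : exists c, [/\ y 0 i <= c, c < y 0 i + (r.-1.+1)%:Z &
    c \notin bad_coords r beta y i ++ bad_coords r beta' y' i].
  by apply: exists_notin_segment; rewrite size_cat !size_bad_coords; lia.
pose z : pt d := \row_i c i.
have zr : inbox r (z - y) by apply/inboxB => j; rewrite mxE; case: (cP j); lia.
have zr' : inbox r (z - y').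
  by apply/inboxB => j; rewrite mxE; have := yy j; case: (cP j); lia.
pose i := Ordinal d2.
have [_ _] := cP i; rewrite mem_cat negb_or => /andP[clean clean'].
have zx : `|f z - f x| <= (hub_diam r)%:R * tau.
  by apply: (dist_hub_le (i := i) tau0 f_grad d2) => //; rewrite mxE.
have zx' : `|f z - f x'| <= (hub_diam r)%:R * tau'.
  by apply: (dist_hub_le (i := i) tau0' f_grad' d2) => //; rewrite mxE.
by rewrite (le_trans (ler_distD (f z) _ _))// mulrDr lerD// distrC.
Qed.

End Gradient.

Definition slow (R : numDomainType) (d : nat) (W : edge d -> R) (s : R) : pred (edge d) :=
  fun e => W e <= s.

Section LocalEnergy.
Variables (R : rcfType) (d : nat) (W : edge d -> R) (f : pt d -> R).
Hypothesis W_ge0 : forall e, 0 <= W e.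
Implicit Types (x y : pt d) (e : edge d).

Definition local_energy (r : nat) y : R :=
  \sum_(e <- ball_edges r y) W e * grad f e ^+ 2.

Lemma local_energy_ge0 r y : 0 <= local_energy r y.
Proof. by apply: sumr_ge0 => e _; rewrite mulr_ge0 ?sqr_ge0. Qed.

Lemma grad_le_off_local_energy r y (s : R) : 0 < s ->
  grad_le_off r (slow W s) y f (Num.sqrt (local_energy r y / s)).
Proof.
move=> s0 e er /=; rewrite -ltNge => /ltW sW.
rewrite -sqrtr_sqr ler_sqrt; last by rewrite divr_ge0 ?local_energy_ge0 // ltW.
rewrite ler_pdivlMr// /local_energy (bigD1_seq e)//= ?uniq_ball_edges//.
rewrite ler_wpDr ?sumr_ge0//; first by move=> e' _; rewrite mulr_ge0 ?sqr_ge0.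
by rewrite mulrC ler_wpM2r ?sqr_ge0.
Qed.

Variable n : nat.
Hypothesis f_supp : forall x, ~ inbox n x -> f x = 0.

Lemma grad_supp e : ~ inbox n.+1 e.1 -> grad f e = 0.
Proof.
move=> en; rewrite /grad !f_supp ?subrr// => inside; apply: en => j; have := inside j.
  by rewrite evD_coord; case: eqP => _; lia.
by lia.
Qed.

Lemma local_energy_supp r y : ~ inbox (n.+1 + r) y -> local_energy r y = 0.
Proof.
move=> yn; rewrite /local_energy big_seq big1// => e /ball_edgesP er.
rewrite grad_supp ?expr0n ?mulr0// => en; apply: yn => j.
by have /inboxB/(_ j) := er; have := en j; lia.
Qed.

Lemma sum_local_energy_le r (N : nat) :
  \sum_(x <- box N) local_energy r x <= ((2 * r + 1) ^ d)%:R * local_energy n.+1 0.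
Proof.
pose h x := \sum_(i <- enum 'I_d) W (x, i) * grad f (x, i) ^+ 2.
have energyE s y : local_energy s y = \sum_(z <- box s) h (y + z).
  by rewrite /local_energy big_allpairs_dep.
have h0 x : 0 <= h x by apply: sumr_ge0 => i _; rewrite mulr_ge0 ?sqr_ge0.
rewrite (eq_bigr _ (fun x _ => energyE r x)) exchange_big/= energyE.
rewrite -size_box -sum1_size natr_sum mulr_suml; apply: ler_sum => z _; rewrite mul1r.
rewrite -(big_map (fun x => x + z) xpredT h).
apply: le_trans (ler_sum_count_mem (k := 1) (l := box n.+1) h0 _ (uniq_box _ _) _) _.
- move=> x /boxP xn; rewrite /h big1// => i _.
  by rewrite grad_supp ?expr0n ?mulr0.
- by move=> x; rewrite count_uniq_mem ?leq_b1// map_inj_uniq ?uniq_box//; exact: addIr.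
- by rewrite mul1r le_eqVlt; apply/predU1P; left; apply: eq_bigr => x _; rewrite add0r.
Qed.

End LocalEnergy.

Section Lines.
Variables (R : realDomainType) (d : nat).

Lemma sum_line_pt_le (h : pt d -> R) (i : 'I_d) (n N : nat) :
  (forall x, 0 <= h x) -> (forall x, ~ inbox N x -> h x = 0) ->
  \sum_(x <- box n) \sum_(0 <= k < 2 * N + 1) h (line_pt N x i k) <=
  (2 * n + 1)%:R * \sum_(x <- box N) h x.
Proof.
move=> h0 hN; rewrite /index_iota subn0.
pose P := [seq (x, k) | x <- box (d := d) n, k <- iota 0 (2 * N + 1)].
pose pt_of (p : pt d * nat) := line_pt N p.1 i p.2.
have -> : \sum_(x <- box n) \sum_(k <- iota 0 (2 * N + 1)) h (line_pt N x i k) =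
    \sum_(v <- map pt_of P) h v by rewrite [RHS]big_map big_allpairs.
apply: ler_sum_count_mem => [//|x /boxP||v]; [exact: hN|exact: uniq_box|].
have uP : uniq P by apply: allpairs_uniq; rewrite ?uniq_box ?iota_uniq// => -[? ?] [].
rewrite count_map -size_filter -(size_map (fun p : pt d * nat => p.1 0 i)).
rewrite -[leqRHS](size_iota 0) -(size_map (fun c : nat => c%:Z - n%:Z)).
apply: uniq_leq_size => [|_ /mapP[[x k] + ->]].
  rewrite map_inj_in_uniq ?filter_uniq// => -[x k] [x' k'].
  rewrite !mem_filter /pt_of/= => /andP[/eqP <- _] /andP[/eqP/rowP line_eq _] xx'.
  congr pair; last by have := line_eq i; rewrite !set_coordE eqxx; lia.
  by apply/rowP => j; have := line_eq j; rewrite !set_coordE; case: eqP => [->|].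
rewrite mem_filter => /andP[_ /allpairsP[[x' k'] /= [/boxP xn _ [-> _]]]].
apply/mapP; exists (absz (x' 0%R i + n%:Z)%R); last by have := xn i => /=; lia.
by rewrite mem_iota; have := xn i => /=; lia.
Qed.

End Lines.

Definition poincare_const (d r : nat) : nat :=
  24 * attach_diam d r ^ 2 * (2 * r + 1) ^ d.

Lemma poincare_const_gt0 (d r : nat) : (0 < poincare_const d r)%N.
Proof. by rewrite !muln_gt0 !expn_gt0 addn1. Qed.

Section WeightedPoincare.
Variables (R : rcfType) (d : nat) (W : edge d -> R) (n r m : nat).
Variables (t S : R) (Z : pt d -> R) (i : 'I_d) (f : pt d -> R).
Hypothesis d_ge2 : (2 <= d)%N.
Hypothesis W_ge0 : forall e, 0 <= W e.
Hypothesis t_gt0 : 0 < t.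
Hypothesis Z_gt0 : forall y, 0 < Z y.
Hypotheses (dm : (2 * d < m)%N) (mr : (2 * m <= r)%N) (rn : (r < n)%N).
Hypothesis untrapped : forall x, inbox n x -> ~~ trapped (slow W t) x.
Hypothesis few_bad : forall y, inbox (2 * n) y -> (nbad r (slow W t) y <= 2 * d)%N.
Hypothesis few_slow : forall y, inbox (2 * n) y -> (nbad r (slow W (Z y)) y < m)%N.
Hypothesis inv_sum_le : forall x, inbox n x ->
  \sum_(0 <= k < 2 * (2 * n) + 1) (Z (line_pt (2 * n) x i k))^-1 <= S.
Hypothesis f_supp : forall x, ~ inbox n x -> f x = 0.

Let level y := Num.max t (Z y).
Let bad y := slow W (level y).
Let energy := local_energy W f r.
Let slope y := Num.sqrt (energy y / level y).

Let level_gt0 y : 0 < level y.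
Proof. by rewrite lt_max t_gt0. Qed.

Let energy_ge0 y : 0 <= energy y.
Proof. exact: local_energy_ge0. Qed.

Let slope_ge0 y : 0 <= slope y.
Proof. exact: sqrtr_ge0. Qed.

Let line_in x k : inbox n x -> (k < 2 * (2 * n) + 1)%N -> inbox (2 * n) (line_pt (2 * n) x i k).
Proof. by move=> xn; apply: inbox_line_pt; apply: inboxW xn; rewrite leq_pmull. Qed.

Lemma nbad_level_lt y : inbox (2 * n) y -> (nbad r (bad y) y < m)%N.
Proof.
move=> yn; have [tZ|/ltW Zt] := leP t (Z y); rewrite /bad /level.
  by rewrite (max_idPr tZ) few_slow.
by rewrite (max_idPl Zt) (leq_ltn_trans (few_bad yn)).
Qed.

Section GivenHubs.
Variable phi : pt d -> pt d.
Hypothesis phi_hub : forall y, inbox (2 * n) y -> hub r (bad y) y (phi y).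

Lemma sqr_dist_phi_le x : inbox n x ->
  (f x - f (phi x)) ^+ 2 <= (attach_diam d r)%:R ^+ 2 * (energy x / t).
Proof.
move=> xn; have x2n : inbox (2 * n) x by apply: inboxW xn; rewrite leq_pmull.
have /allPn[e ex et] := untrapped xn.
have energy_t : 0 <= energy x / t by rewrite divr_ge0// ltW.
have dist_le : `|f x - f (phi x)| <= (attach_diam d r)%:R * Num.sqrt (energy x / t).
  apply: (dist_hub_attached_le (sqrtr_ge0 _) (grad_le_off_local_energy f W_ge0 t_gt0) d_ge2
    _ _ _ ex et).
  - by lia.
  - exact: few_bad.
  - by apply: hub_sub (phi_hub x2n) => e' /le_trans; apply; rewrite le_max lexx.
rewrite -real_normK ?num_real// -(sqr_sqrtr energy_t) -exprMn.
by rewrite ler_sqr ?nnegrE ?mulr_ge0 ?sqrtr_ge0 ?ler0n.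
Qed.

(* Walk along the line to its end, where the hub lies outside the support.   *)
Lemma norm_phi_le x : inbox n x ->
  `|f (phi x)| <=
  2 * (hub_diam d r)%:R * \sum_(0 <= k < 2 * (2 * n) + 1) slope (line_pt (2 * n) x i k).
Proof.
move=> xn; pose y := line_pt (2 * n) x i.
pose k0 := absz (x 0%R i + (2 * n)%N%:Z)%R; pose K := (2 * (2 * n))%N.
have k0K : (k0 <= K)%N by rewrite /k0 /K; have := xn i; lia.
have yk0 : y k0 = x.
  rewrite -[RHS](set_coord_id x i) /y /line_pt; congr set_coord.
  by rewrite /k0; have := xn i; lia.
have end_out : f (phi (y K)) = 0.
  have yKin : inbox (2 * n) (y K) by apply: line_in => //; rewrite addn1.
  have [/inboxB/(_ i) close _] := phi_hub yKin.
  apply: f_supp => /(_ i); move: close.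
  by rewrite [y K 0 i]set_coordE eqxx /K; lia.
have walk : `|f (phi (y k0)) - f (phi (y K))| <=
    \sum_(k0 <= k < K) (hub_diam d r)%:R * (slope (y k) + slope (y k.+1)).
  apply: (dist_telescope_le (u := f \o phi \o y)) => // k /andP[_ kK] /=.
  have kin : inbox (2 * n) (y k) by apply: line_in => //; rewrite addn1 ltnW.
  have kin' : inbox (2 * n) (y k.+1) by apply: line_in => //; rewrite addn1.
  apply: (dist_neighbor_hubs_le d_ge2 (slope_ge0 _) (slope_ge0 _) _ _ _ _
    (phi_hub kin) (phi_hub kin')).
  - exact: grad_le_off_local_energy.
  - exact: grad_le_off_local_energy.
  - by apply/inboxB => j; rewrite !set_coordE; case: eqP => _; lia.
  - by have := nbad_level_lt kin; have := nbad_level_lt kin'; lia.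
have -> : f (phi x) = f (phi (y k0)) - f (phi (y K)) by rewrite yk0 end_out subr0.
rewrite (le_trans walk)// -mulr_sumr mulrAC [leRHS]mulrC.
rewrite ler_wpM2l ?ler0n// mulr_natl mulr2n big_split/= lerD//.
  by apply: ler_sum_nat_sub; rewrite ?addn1.
have -> : \sum_(k0 <= k < K) slope (y k.+1) = \sum_(k0.+1 <= k < K.+1) slope (y k).
  by rewrite big_add1.
by apply: ler_sum_nat_sub; rewrite ?addn1.
Qed.

Lemma sqr_phi_le x : inbox n x ->
  f (phi x) ^+ 2 <= 4 * (hub_diam d r)%:R ^+ 2 *
    (S * \sum_(0 <= k < 2 * (2 * n) + 1) energy (line_pt (2 * n) x i k)).
Proof.
move=> xn; pose y := line_pt (2 * n) x i.
have sum_slope_ge0 : 0 <= \sum_(0 <= k < 2 * (2 * n) + 1) slope (y k) by apply: sumr_ge0.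
apply: (@le_trans _ _ ((2 * (hub_diam d r)%:R * \sum_(0 <= k < 2 * (2 * n) + 1) slope (y k)) ^+ 2)).
  by rewrite -real_normK ?num_real// ler_sqr ?nnegrE ?mulr_ge0 ?ler0n// norm_phi_le.
rewrite exprMn [in leLHS]exprMn -[2 ^+ 2]natrX ler_wpM2l ?mulr_ge0 ?sqr_ge0//.
pose a k := Num.sqrt (Z (y k))^-1; pose b k := Num.sqrt (energy (y k)).
have slope_le : \sum_(0 <= k < 2 * (2 * n) + 1) slope (y k) <=
    \sum_(0 <= k < 2 * (2 * n) + 1) a k * b k.
  apply: ler_sum => k _; rewrite /slope mulrC sqrtrM ?invr_ge0 ?(ltW (level_gt0 _))//.
  by rewrite ler_wpM2r ?sqrtr_ge0// ler_wsqrtr// lef_pV2 ?posrE// le_max lexx orbT.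
have -> : \sum_(0 <= k < 2 * (2 * n) + 1) energy (y k) =
    \sum_(0 <= k < 2 * (2 * n) + 1) b k ^+ 2.
  by apply: eq_bigr => k _; rewrite sqr_sqrtr.
apply: le_trans (le_trans (sum_cauchy_schwarz (index_iota 0 (2 * (2 * n) + 1)) a b) _).
  by rewrite ler_sqr ?nnegrE// (le_trans sum_slope_ge0).
rewrite ler_wpM2r//; first by apply: sumr_ge0 => k _; exact: sqr_ge0.
rewrite (le_trans _ (inv_sum_le xn))// le_eqVlt; apply/predU1P; left.
by apply: eq_bigr => k _; rewrite sqr_sqrtr// invr_ge0 ltW.
Qed.

Lemma sum_sqr_le :
  \sum_(x <- box n) f x ^+ 2 <=
  (poincare_const d r)%:R * (t^-1 + n%:R * S) * local_energy W f n.+1 0.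
Proof.
set K := attach_diam d r; set F := ((2 * r + 1) ^ d)%N; set E := local_energy W f n.+1 0.
have n_gt0 : (0 < n)%N by exact: leq_ltn_trans rn.
have E0 : 0 <= E by exact: local_energy_ge0.
have S0 : 0 <= S.
  apply: le_trans (inv_sum_le (x := 0) _); last by move=> j; rewrite mxE.
  by apply: sumr_ge0 => k _; rewrite invr_ge0 ltW.
have pointwise x : x \in box n -> f x ^+ 2 <= 2 * K%:R ^+ 2 / t * energy x +
    8 * K%:R ^+ 2 * S * \sum_(0 <= k < 2 * (2 * n) + 1) energy (line_pt (2 * n) x i k).
  move=> /boxP xn; have := sqrD_le (f x - f (phi x)) (f (phi x)); rewrite subrK.
  move=> /le_trans; apply.
  have := sqr_dist_phi_le xn; rewrite -/K.
  have := sqr_phi_le xn.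
  have hub_attach : (hub_diam d r)%:R ^+ 2 <= K%:R ^+ 2 :> R.
    by rewrite ler_sqr ?nnegrE ?ler0n// ler_nat leq_addl.
  have line_ge0 : 0 <= S * \sum_(0 <= k < 2 * (2 * n) + 1) energy (line_pt (2 * n) x i k).
    by rewrite mulr_ge0 ?sumr_ge0.
  by have := ler_wpM2r line_ge0 hub_attach; lra.
rewrite big_seq (le_trans (ler_sum _ pointwise))// -big_seq big_split/= -!mulr_sumr.
have total : \sum_(x <- box n) energy x <= F%:R * E by exact: sum_local_energy_le.
have total_lines : \sum_(x <- box n) \sum_(0 <= k < 2 * (2 * n) + 1)
    energy (line_pt (2 * n) x i k) <= 3 * n%:R * (F%:R * E).
  apply: (le_trans (sum_line_pt_le (N := 2 * n) i n energy_ge0 _)).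
    move=> x xn; apply: (local_energy_supp W f_supp) => inside.
    by apply: xn; apply: inboxW inside; lia.
  apply: ler_pM => //; first by apply: sumr_ge0 => x _.
    by rewrite -natrM ler_nat; lia.
  exact: sum_local_energy_le.
have first_term : 2 * K%:R ^+ 2 / t * \sum_(x <- box n) energy x <=
    2 * K%:R ^+ 2 / t * (F%:R * E).
  by rewrite ler_wpM2l// divr_ge0 ?mulr_ge0 ?sqr_ge0// ltW.
apply: le_trans (lerD first_term (ler_wpM2l _ total_lines)) _.
  by rewrite !mulr_ge0 ?sqr_ge0.
rewrite /poincare_const -/K -/F !natrM.
have : 0 <= K%:R ^+ 2 / t * (F%:R * E).
  by rewrite mulr_ge0 ?divr_ge0 ?mulr_ge0 ?sqr_ge0 ?ler0n// ltW.
by lra.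
Qed.

End GivenHubs.

Lemma weighted_poincare :
  \sum_(x <- box n) f x ^+ 2 <=
  (poincare_const d r)%:R * (t^-1 + n%:R * S) * local_energy W f n.+1 0.
Proof.
have /choice[phi phi_hub] y : exists x, inbox (2 * n) y -> hub r (bad y) y x.
  have [yn|] := pselect (inbox (2 * n) y); last by exists 0.
  have [|x hub_x] := @exists_hub _ r (bad y) y; last by exists x.
  by have := nbad_level_lt yn; lia.
exact: sum_sqr_le phi_hub.
Qed.

End WeightedPoincare.

Section Eigenvalue.
Variables (R : realType) (d : nat) (W : edge d -> R).
Hypothesis W_ge0 : forall e, 0 <= W e.

Lemma cond_ge0 x y : 0 <= cond W x y.
Proof. by rewrite /cond; do 2?case: pickP. Qed.

Lemma cond_ev x i : cond W x (x + ev i) = W (x, i).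
Proof.
rewrite /cond; case: pickP => [j /eqP/addrI/ev_inj -> //|/(_ i)].
by rewrite eqxx.
Qed.

(* The Dirichlet form counts every edge from both endpoints; dropping one of *)
(* the two terms costs the factor 2.                                         *)
Lemma local_energy_le_dirichlet (n : nat) f :
  local_energy W f n.+1 0 <= 2 * dirichlet W n f.
Proof.
rewrite /dirichlet mulVKf// /local_energy big_allpairs_dep big_image/=.
apply: ler_sum => k _; rewrite big_enum/=; apply: ler_sum => i _.
by rewrite big_bool/= cond_ev add0r lerDl mulr_ge0 ?cond_ge0 ?sqr_ge0.
Qed.

Lemma lambda1_ge (n : nat) (K : R) : 0 < K ->
  (forall f, (forall x, ~ inbox n x -> f x = 0) ->
     \sum_(x <- box n) f x ^+ 2 <= K * local_energy W f n.+1 0) ->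
  (2 * K)^-1 <= lambda1 W n.
Proof.
move=> K0 poincare; apply: lb_le_inf.
  pose f (x : pt d) : R := (x == 0)%:R.
  have f_out x : x != 0 -> f x = 0 by rewrite /f => /negbTE ->.
  exists (dirichlet W n f); exists f => //; split=> [x xn|].
    by apply: f_out; apply: contra_not_neq xn => -> j; rewrite mxE.
  rewrite (big_box _ (fun x => f x ^+ 2)) (bigD1_seq 0)//= ?uniq_box//; last first.
    by apply/boxP => j; rewrite mxE.
  by rewrite /f eqxx expr1n big1 ?addr0// => x /f_out; rewrite /f => ->; rewrite expr0n.
move=> _ [f [f_supp f_norm] <-].
have := poincare f f_supp; rewrite -(big_box n (fun x => f x ^+ 2)) f_norm => energy_ge.
rewrite -[leLHS]mul1r ler_pdivrMr ?mulr_gt0// (le_trans energy_ge)//.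
rewrite [2 * K]mulrC mulrCA [_ * 2]mulrC.
by rewrite ler_wpM2l ?(ltW K0)// local_energy_le_dirichlet.
Qed.

End Eigenvalue.

(** * Expectations of independent bits *)

Section BitMean.
Variables (R : realFieldType) (E : eqType) (p : E -> R).
Hypothesis p01 : forall e, 0 <= p e <= 1.
Implicit Types (b : E -> bool) (F G : (E -> bool) -> R) (s : seq E) (A B : pred E) (e : E).

Definition upd b e (v : bool) : E -> bool := fun x => if x == e then v else b x.

(* Expectation of F when the bits on s are independent with parameters p and *)
(* the other bits are frozen to b.                                           *)
Fixpoint mean s F b : R :=
  if s is e :: s' then
    p e * mean s' F (upd b e true) + (1 - p e) * mean s' F (upd b e false)
  else F b.

Definition depends_on (U : Type) A (F : (E -> bool) -> U) : Prop :=
  forall b b', {in A, b =1 b'} -> F b = F b'.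

Definition disjoint_family (I : eqType) (l : seq I) (A : I -> pred E) : Prop :=
  forall i j e, i \in l -> j \in l -> i != j -> A i e -> ~~ A j e.

Lemma depends_on_sub (U : Type) A B (F : (E -> bool) -> U) :
  {subset A <= B} -> depends_on A F -> depends_on B F.
Proof. by move=> AB FA b b' bb'; apply: FA => e /AB; exact: bb'. Qed.

Lemma depends_on_comp (U V : Type) A (F : (E -> bool) -> U) (h : U -> V) :
  depends_on A F -> depends_on A (h \o F).
Proof. by move=> FA b b' bb' /=; rewrite (FA b b'). Qed.

Lemma eq_mean s F G b : F =1 G -> mean s F b = mean s G b.
Proof. by move=> FG; elim: s b => [|e s IH] b /=; rewrite ?FG ?IH. Qed.

Lemma le_mean s F G b : (forall b, F b <= G b) -> mean s F b <= mean s G b.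
Proof.
move=> FG; elim: s b => [|e s IH] b //=; have /andP[p0 p1] := p01 e.
by rewrite lerD// ler_wpM2l// subr_ge0.
Qed.

Lemma mean_cst s (c : R) b : mean s (fun=> c) b = c.
Proof. by elim: s b => [|e s IH] b //=; rewrite !IH; ring. Qed.

Lemma mean_ge0 s F b : (forall b, 0 <= F b) -> 0 <= mean s F b.
Proof. by move=> F0; rewrite -(mean_cst s 0 b); exact: le_mean. Qed.

Lemma meanD s F G b : mean s (fun b => F b + G b) b = mean s F b + mean s G b.
Proof. by elim: s b => [|e s IH] b //=; rewrite !IH; ring. Qed.

Lemma meanB s F G b : mean s (fun b => F b - G b) b = mean s F b - mean s G b.
Proof. by elim: s b => [|e s IH] b //=; rewrite !IH; ring. Qed.

Lemma meanZ s (c : R) F b : mean s (fun b => c * F b) b = c * mean s F b.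
Proof. by elim: s b => [|e s IH] b //=; rewrite !IH; ring. Qed.

Lemma mean_sum (I : Type) (l : seq I) s (F : I -> (E -> bool) -> R) b :
  mean s (fun b => \sum_(i <- l) F i b) b = \sum_(i <- l) mean s (F i) b.
Proof.
elim: l => [|i l IH].
  by rewrite big_nil -[RHS](mean_cst s 0 b); apply: eq_mean => b'; rewrite big_nil.
by rewrite big_cons -IH -meanD; apply: eq_mean => b'; rewrite big_cons.
Qed.

Lemma mean_depends s F A : depends_on A F -> depends_on A (mean s F).
Proof.
move=> FA; elim: s => [|e s IH] //= b b' bb'.
by congr (_ * _ + _ * _); apply: IH => x xA; rewrite /upd; case: eqP => // _; exact: bb'.
Qed.

Lemma mean_indep s F G A B b : depends_on A F -> depends_on B G ->
  (forall e, A e -> ~~ B e) ->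
  mean s (fun b => F b * G b) b = mean s F b * mean s G b.
Proof.
move=> FA GB AB; elim: s b => [|e s IH] b //=; rewrite !IH.
have frozen H (C : pred E) : depends_on C H -> ~~ C e ->
    mean s H (upd b e true) = mean s H (upd b e false).
  move=> HC Ce; apply: (mean_depends s HC) => x xC; rewrite /upd.
  by case: eqP => // xe; move: xC; rewrite unfold_in xe (negbTE Ce).
have [Ae|nAe] := boolP (A e).
  by rewrite -(frozen G B GB (AB e Ae)); ring.
by rewrite -(frozen F A FA nAe); ring.
Qed.

Lemma mean_prod (I : eqType) (l : seq I) s (F : I -> (E -> bool) -> R) (A : I -> pred E) b :
  uniq l -> (forall i, i \in l -> depends_on (A i) (F i)) -> disjoint_family l A ->
  mean s (fun b => \prod_(i <- l) F i b) b = \prod_(i <- l) mean s (F i) b.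
Proof.
elim: l => [_ _ _|i l IH /= /andP[il ul] FA disj].
  by rewrite big_nil -[RHS](mean_cst s 1 b); apply: eq_mean => b'; rewrite big_nil.
have lS j : j \in l -> j \in i :: l by move=> jl; rewrite inE jl orbT.
rewrite big_cons -IH//; last 2 first.
- by move=> j /lS; exact: FA.
- by move=> j k e /lS jl /lS kl; exact: disj.
rewrite -(@mean_indep s (F i) _ (A i) (fun e => has (fun j => A j e) l)).
- by apply: eq_mean => b'; rewrite big_cons.
- by apply: FA; rewrite mem_head.
- move=> b1 b2 bb; rewrite !big_seq; apply: eq_bigr => j jl.
  by apply: (FA j (lS j jl)) => e Aje; apply: bb; apply/hasP; exists j.
- move=> e Aie; apply/hasPn => j jl; apply: (disj i j) => //; rewrite ?mem_head ?lS//.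
  by apply: contraNneq il => ->.
Qed.

Lemma mean_bit s e b : mean s (fun b => (b e)%:R) b = if e \in s then p e else (b e)%:R.
Proof.
elim: s b => [|e' s IH] b //=; rewrite !IH inE /upd; case: eqVneq => [<-|_] /=.
  by case: ifP => _; ring.
by case: ifP => _; ring.
Qed.

Lemma bit_depends e : depends_on (pred1 e) (fun b => (b e)%:R : R).
Proof. by move=> b b' /(_ e); rewrite inE => ->. Qed.

Lemma all_depends (l : seq E) : depends_on (mem l) (fun b => all b l).
Proof. by move=> b b' bb'; apply: eq_in_all => e; exact: bb'. Qed.

Lemma count_depends (l : seq E) : depends_on (mem l) (fun b => count b l).
Proof. by move=> b b' bb'; apply: eq_in_count => e; exact: bb'. Qed.

Lemma mean_all s (l : seq E) b : uniq l -> {subset l <= s} ->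
  mean s (fun b => (all b l)%:R) b = \prod_(e <- l) p e.
Proof.
move=> ul ls.
have allE b' : (all b' l)%:R = \prod_(e <- l) (b' e)%:R :> R.
  elim: (l) => [|e k IH] /=; first by rewrite big_nil.
  by rewrite big_cons -IH; case: (b' e); rewrite ?mul1r ?mul0r.
rewrite (eq_mean _ _ allE) (@mean_prod E l s _ (fun e => pred1 e))//.
- by rewrite !big_seq; apply: eq_bigr => e el; rewrite mean_bit ls.
- by move=> e _; exact: bit_depends.
- by move=> i j e _ _ ij /eqP ->.
Qed.

Lemma mean_has_le (I : Type) (l : seq I) s (F : I -> (E -> bool) -> bool) b :
  mean s (fun b => (has (F^~ b) l)%:R) b <= \sum_(i <- l) mean s (fun b => (F i b)%:R) b.
Proof.
rewrite -mean_sum; apply: le_mean => b'; elim: l => [|i l IH] /=; first by rewrite big_nil.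
rewrite big_cons; apply: le_trans (lerD (lexx _) IH).
by case: (F i b'); rewrite ?lerDl ?add0r ?ler0n.
Qed.

Lemma mean_count_ge_le s (l : seq E) (q : R) (m : nat) b :
  uniq l -> {subset l <= s} -> 0 <= q -> (forall e, e \in l -> p e <= q) ->
  mean s (fun b => (m <= count b l)%N%:R) b <= 2 ^+ size l * q ^+ m.
Proof.
move=> + + q0; elim: l m => [|e l IH] [|m] /=.
- by rewrite mean_cst expr0 mulr1.
- by rewrite mean_cst mulr_ge0 ?exprn_ge0.
- by rewrite mean_cst !expr0 mulr1 exprn_ege1// ler1n.
move=> /andP[el ul] els pq.
have ls : {subset l <= s} by move=> x xl; apply: els; rewrite inE xl orbT.
have {}IH k := IH k ul ls (fun x xl => pq x (mem_behead (s := e :: l) xl)).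
apply: (@le_trans _ _ (mean s (fun b => (b e)%:R * (m <= count b l)%N%:R) b +
    mean s (fun b => (m < count b l)%N%:R) b)).
  rewrite -meanD; apply: le_mean => b'.
  by case: (b' e); rewrite ?mul1r ?mul0r ?add0r// add1n ltnS lerDl.
rewrite (mean_indep _ (A := pred1 e) (B := mem l)); first last.
- by move=> x /eqP ->.
- by apply: (depends_on_comp (fun k => (m <= k)%N%:R)); exact: count_depends.
- exact: bit_depends.
rewrite mean_bit els ?mem_head// exprS -mulrA [2 * _]mulr_natl mulr2n lerD//.
rewrite exprS mulrCA ler_pM ?IH ?pq ?mem_head//; first by case/andP: (p01 e).
by apply: mean_ge0 => b'; exact: ler0n.
Qed.

Lemma prod_1D_bool (I : Type) (l : seq I) (F : I -> bool) :
  \prod_(i <- l) (1 + (F i)%:R) = 2 ^+ count F l :> R.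
Proof.
elim: l => [|i l IH]; first by rewrite big_nil.
by rewrite big_cons IH /=; case: (F i); rewrite ?addr0 ?mul1r// exprS.
Qed.

(* Exponential Markov inequality for [2 ^ count], whose mean is a product.   *)
Lemma mean_count_tail_le (I : eqType) (l : seq I) s (F : I -> (E -> bool) -> bool)
    (A : I -> pred E) (q : R) (k : nat) b :
  uniq l -> (forall i, i \in l -> depends_on (A i) (F i)) -> disjoint_family l A ->
  (forall i, i \in l -> mean s (fun b => (F i b)%:R) b <= q) ->
  (1 + q) ^+ size l <= 2 ^+ k ->
  mean s (fun b => (2 * k < count (F^~ b) l)%N%:R) b <= 2 ^- k.
Proof.
move=> ul FA disj Fq q2.
have markov b' : (2 * k < count (F^~ b') l)%N%:R <=
    2 ^- (2 * k) * \prod_(i <- l) (1 + (F i b')%:R) :> R.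
  rewrite prod_1D_bool mulrC ler_pdivlMr ?exprn_gt0//.
  by case: ltnP => [/ltnW le|_]; rewrite ?mul1r ?mul0r ?exprn_ge0// ler_eXn2l// ltr1n.
apply: le_trans (le_mean s b markov) _; rewrite meanZ (mean_prod _ _ ul _ disj); last first.
  by move=> i il; apply: (depends_on_comp (fun v : bool => 1 + v%:R)); exact: FA.
have prod_le : \prod_(i <- l) mean s (fun b => 1 + (F i b)%:R) b <= 2 ^+ k.
  apply: le_trans q2; rewrite -count_predT -iter_mulr_1 -big_const_seq !big_seq.
  apply: ler_prod => i il; rewrite mean_ge0/= => [|b']; last by rewrite addr_ge0 ?ler0n.
  by rewrite meanD mean_cst lerD2l Fq.
apply: le_trans (ler_wpM2l _ prod_le) _; first by rewrite invr_ge0 exprn_ge0.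
by rewrite mulnC muln2 -addnn exprD invfM -mulrA mulVf ?mulr1// expf_neq0.
Qed.

Definition antitone F : Prop := forall b b', (forall e, b e -> b' e) -> F b' <= F b.

Lemma mean_antitone s F : antitone F -> antitone (mean s F).
Proof.
move=> FM; elim: s => [|e s IH] //= b b' bb'; have /andP[p0 p1] := p01 e.
rewrite lerD// ler_wpM2l ?subr_ge0//; apply: IH => x; rewrite /upd; case: eqP => // _; exact: bb'.
Qed.

Lemma harris s F G b : antitone F -> antitone G ->
  mean s F b * mean s G b <= mean s (fun b => F b * G b) b.
Proof.
move=> FM GM; elim: s b => [|e s IH] b //=; have /andP[p0 p1] := p01 e.
have up x : upd b e false x -> upd b e true x by rewrite /upd; case: eqP.
have := mean_antitone s FM up; have := mean_antitone s GM up.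
have := IH (upd b e true); have := IH (upd b e false).
move: (mean s F (upd b e true)) (mean s F (upd b e false)) => F1 F0.
move: (mean s G (upd b e true)) (mean s G (upd b e false)) => G1 G0.
move: (mean s _ (upd b e true)) (mean s _ (upd b e false)) => H1 H0 IH0 IH1 GD FD.
have q0 : 0 <= 1 - p e by rewrite subr_ge0.
have := ler_wpM2l p0 IH1; have := ler_wpM2l q0 IH0.
have : 0 <= p e * (1 - p e) * ((F0 - F1) * (G0 - G1)) by rewrite !mulr_ge0// subr_ge0.
by move: (p e) => q; nra.
Qed.

Lemma harris_prod (I : Type) (l : seq I) s (F : I -> (E -> bool) -> R) b :
  (forall i b, 0 <= F i b) -> (forall i, antitone (F i)) ->
  \prod_(i <- l) mean s (F i) b <= mean s (fun b => \prod_(i <- l) F i b) b.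
Proof.
move=> F0 FM; elim: l => [|i l IH].
  by rewrite big_nil -[leLHS](mean_cst s 1 b); apply: le_mean => b'; rewrite big_nil.
rewrite big_cons; apply: le_trans (ler_wpM2l (mean_ge0 s b (F0 i)) IH) _.
apply: le_trans (harris s b (FM i) _) _.
  by move=> b1 b2 bb; apply: ler_prod => j _; rewrite F0/=; exact: FM.
by apply: le_mean => b'; rewrite big_cons.
Qed.

Lemma mean_has_all_le (L : seq (seq E)) s b :
  (forall l, l \in L -> uniq l /\ {subset l <= s}) ->
  mean s (fun b => (has (all b) L)%:R) b <= 1 - \prod_(l <- L) (1 - \prod_(e <- l) p e).
Proof.
move=> Ls.
have hasE b' : (has (all b') L)%:R = 1 - \prod_(l <- L) (1 - (all b' l)%:R) :> R.
  elim: (L) => [|l K IH] /=; first by rewrite big_nil subrr.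
  by rewrite big_cons; case: (all b' l) => /=; rewrite ?subrr ?mul0r ?subr0 ?mul1r.
rewrite (eq_mean _ _ hasE) meanB mean_cst lerD2l lerN2.
apply: le_trans (harris_prod _ _ _ _ _); first last.
- move=> l b1 b2 bb; rewrite lerD2l lerN2 ler_nat.
  by case: (boolP (all b1 l)) => // /(sub_all (fun e => bb e)) ->.
- by move=> l b'; rewrite subr_ge0; case: (all b' l).
rewrite le_eqVlt !big_seq; apply/predU1P; left; apply: eq_bigr => l /Ls[ul ls].
by rewrite meanB mean_cst mean_all.
Qed.

End BitMean.

Section IndependentBits.
Variables (R : realType) (dd : measure_display) (T : measurableType dd) (P : probability T R).
Variables (E : eqType) (xi : T -> E -> bool) (p : E -> R).
Implicit Types (s r : seq E) (b v : E -> bool).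

Let agree s v : set T := [set om | {in s, xi om =1 v}].

Let weight s v : R := \prod_(e <- s) (if v e then p e else 1 - p e).

Hypothesis xi_measurable : forall e (v : bool), measurable [set om | xi om e = v].
Hypothesis xi_indep : forall s v, uniq s -> P (agree s v) = (weight s v)%:E.

Lemma agree_measurable s v : measurable (agree s v).
Proof.
have -> : agree s v = \bigcap_(e in [set` s]) [set om | xi om e = v e] by [].
by apply: fin_bigcap_measurable => [|e _]; [exact: finite_seq|exact: xi_measurable].
Qed.

Lemma agree_cons_upd e s v (x : bool) om : e \notin s ->
  agree (e :: s) (upd v e x) om <-> xi om e = x /\ agree s v om.
Proof.
move=> es; rewrite /agree /=; split=> [ag|[ex sv] y].
  split=> [|y ys]; first by rewrite ag ?mem_head// /upd eqxx.
  by rewrite ag ?inE ?ys ?orbT// /upd; case: eqP ys => // ->; rewrite (negbTE es).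
by rewrite inE /upd; case: eqP => [->|_] //= ys; exact: sv.
Qed.

Lemma weight_cons_upd e s v (x : bool) : e \notin s ->
  weight (e :: s) (upd v e x) = (if x then p e else 1 - p e) * weight s v.
Proof.
move=> es; rewrite /weight big_cons /upd eqxx; congr (_ * _); rewrite !big_seq.
by apply: eq_bigr => y ys; case: eqP ys => // ->; rewrite (negbTE es).
Qed.

Lemma prob_bits_agree r s (F : (E -> bool) -> bool) v :
  uniq (r ++ s) -> depends_on (mem (r ++ s)) F ->
  measurable (agree r v `&` [set om | F (xi om)]) /\
  P (agree r v `&` [set om | F (xi om)]) =
  (weight r v * mean p s (fun b => (F b)%:R) v)%:E.
Proof.
elim: s r v => [|e s IH] r v urs Fdep.
  rewrite cats0 in urs Fdep.
  have -> : agree r v `&` [set om | F (xi om)] = if F v then agree r v else set0.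
    apply/seteqP; split=> om.
      by move=> [] rv /=; rewrite (Fdep _ v)//; case: (F v).
    by case Fv : (F v) => //= rv; split=> //=; rewrite (Fdep _ v).
  rewrite /=; case: (F v); rewrite ?mulr1 ?mulr0.
    by split; [exact: agree_measurable|exact: xi_indep].
  by split; [exact: measurable0|rewrite measure0].
have er : e \notin r.
  by move: urs; rewrite cat_uniq /= negb_or => /and3P[_ /andP[]].
have perm_ers : perm_eq (e :: r ++ s) (r ++ e :: s).
  by rewrite perm_sym -[e :: s]cat1s perm_catCA.
pose A x := agree (e :: r) (upd v e x) `&` [set om | F (xi om)].
have split_e : agree r v `&` [set om | F (xi om)] = A true `|` A false.
  apply/seteqP; split=> om; last by case=> -[/(agree_cons_upd _ _ _ er)[_ rv] Fom].
  move=> [rv Fom].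
  by case xe : (xi om e); [left|right]; split=> //; apply/agree_cons_upd.
have given_e x : measurable (A x) /\ P (A x) = ((if x then p e else 1 - p e) * weight r v *
    mean p s (fun b => (F b)%:R) (upd v e x))%:E.
  rewrite -weight_cons_upd//; apply: IH; first by rewrite (perm_uniq perm_ers).
  by apply: depends_on_sub Fdep => y; rewrite (perm_mem perm_ers).
have [[mA1 PA1] [mA0 PA0]] := (given_e true, given_e false).
rewrite split_e; split; first exact: measurableU.
rewrite measureU//; last first.
  apply/seteqP; split=> om // [[/(agree_cons_upd _ _ _ er)[et _] _]].
  by case=> /(agree_cons_upd _ _ _ er)[]; rewrite et.
by rewrite [X in (X + _)%E]PA1 [X in (_ + X)%E]PA0 -EFinD /=; congr (_%:E); ring.
Qed.

Lemma prob_bits s (F : (E -> bool) -> bool) v : uniq s -> depends_on (mem s) F ->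
  measurable [set om | F (xi om)] /\
  P [set om | F (xi om)] = (mean p s (fun b => (F b)%:R) v)%:E.
Proof.
move=> us Fdep; have [] := @prob_bits_agree [::] s F v us Fdep.
have -> : agree [::] v `&` [set om | F (xi om)] = [set om | F (xi om)].
  by apply/seteqP; split=> om //= [].
by rewrite /weight big_nil mul1r.
Qed.

End IndependentBits.

(** * Probabilities of configurations of slow edges *)

Definition line_count (d r m n a : nat) (beta : pred (edge d)) (x : pt d) (i : 'I_d) : nat :=
  count (fun k => (m <= nbad r beta (line_pt n x i k))%N)
    [seq k <- iota 0 (2 * n + 1) | (k %% (2 * r + 1) == a)%N].

Lemma disjoint_line_balls (d r n a : nat) (x : pt d) (i : 'I_d) :
  disjoint_family [seq k <- iota 0 (2 * n + 1) | (k %% (2 * r + 1) == a)%N]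
    (fun k => mem (ball_edges r (line_pt n x i k))).
Proof.
move=> k k' e; rewrite !mem_filter => /andP[/eqP ka _] /andP[/eqP k'a _] kk' /ball_edgesP ek.
apply/negP => /ball_edgesP ek'; move/eqP: kk'; apply.
have /inboxB/(_ i) := ek; have /inboxB/(_ i) := ek'.
rewrite !set_coordE eqxx; move: (e.1 0 i) => z z' zk.
rewrite (divn_eq k (2 * r + 1)) (divn_eq k' (2 * r + 1)) ka k'a.
move: (divn_eq k (2 * r + 1)) (divn_eq k' (2 * r + 1)); rewrite ka k'a.
move: (k %/ (2 * r + 1))%N (k' %/ (2 * r + 1))%N => q q' kE k'E.
congr (_ * _ + _)%N; apply/eqP; rewrite eqn_leq; apply/andP; split;
  rewrite leqNgt; apply/negP => /(fun lt => leq_mul lt (leqnn (2 * r + 1))); lia.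
Qed.

Lemma trapped_depends (d : nat) (x : pt d) : depends_on (mem (star x)) (fun b => trapped b x).
Proof. exact: all_depends. Qed.

Lemma nbad_ge_depends (d r m : nat) (y : pt d) :
  depends_on (mem (ball_edges r y)) (fun b => (m <= nbad r b y)%N).
Proof. exact: (depends_on_comp (leq m) (@count_depends _ (ball_edges r y))). Qed.

Definition crowded_ball (d r m n : nat) (beta : pred (edge d)) : bool :=
  has (fun y => m <= nbad r beta y)%N (box n).

Definition crowded_line (d r m n k : nat) (i : 'I_d) (beta : pred (edge d)) : bool :=
  has (fun xa => k < line_count r m n xa.2 beta xa.1 i)%N
    [seq (x, a) | x <- box n, a <- iota 0 (2 * r + 1)].

Lemma not_crowded_ball (d r m n : nat) (beta : pred (edge d)) y :
  ~ crowded_ball r m n beta -> inbox n y -> (nbad r beta y < m)%N.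
Proof. by move=> /negP/hasPn sparse /boxP/sparse; rewrite ltnNge. Qed.

Lemma not_crowded_line (d r m n k : nat) (i : 'I_d) (beta : pred (edge d)) x a :
  ~ crowded_line r m n k i beta -> inbox n x -> (a < 2 * r + 1)%N ->
  (line_count r m n a beta x i <= k)%N.
Proof.
move=> /negP/hasPn sparse /boxP xn ar; rewrite leqNgt; apply: (sparse (x, a)).
by apply: allpairs_f; rewrite // mem_iota.
Qed.

Definition ball_card (d r : nat) : nat := ((2 * r + 1) ^ d * d)%N.

Section SlowEdges.
Variables (R : realType) (dd : measure_display) (T : measurableType dd).
Variables (P : probability T R) (d : nat) (w : edge d -> T -> R) (e0 : edge d).
Hypothesis iid : iid_env P w.
Implicit Types (s : R) (e : edge d) (t : edge d -> R).

Definition edge_cdf s : R := fine (P [set om | w e0 om <= s]).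

Let slow_at s om : pred (edge d) := slow (w^~ om) s.

Lemma edge_preimage_measurable e (B : set R) : measurable B -> measurable (w e @^-1` B).
Proof.
by move=> mB; have [mw _ _ _] := iid; rewrite -[X in measurable X]setTI; exact: mw.
Qed.

Lemma prob_edge_le e s : P (w e @^-1` `]-oo, s]) = (edge_cdf s)%:E.
Proof.
have [_ _ id _] := iid; rewrite (id e e0) ; last exact: measurable_itv.
rewrite /edge_cdf (_ : [set om | _] = w e0 @^-1` `]-oo, s]).
  by rewrite fineK// fin_num_measure//; apply: edge_preimage_measurable; exact: measurable_itv.
by apply/seteqP; split=> om /=; rewrite in_itv.
Qed.

Lemma edge_cdf01 s : 0 <= edge_cdf s <= 1.
Proof.
rewrite -!lee_fin -(prob_edge_le e0) measure_ge0 probability_le1//.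
by apply: edge_preimage_measurable; exact: measurable_itv.
Qed.

Lemma le_edge_cdf : {homo edge_cdf : s s' / s <= s'}.
Proof.
move=> s s' ss'; rewrite -lee_fin -!(prob_edge_le e0).
apply: le_measure; rewrite ?inE; try by apply: edge_preimage_measurable; exact: measurable_itv.
by move=> om /=; rewrite !in_itv/= => /le_trans; apply.
Qed.

Lemma prob_threshold_event t l (F : pred (edge d) -> bool) : uniq l ->
  depends_on (mem l) F ->
  measurable [set om | F (fun e => w e om <= t e)] /\
  P [set om | F (fun e => w e om <= t e)] =
  (mean (edge_cdf \o t) l (fun b => (F b)%:R) xpred0)%:E.
Proof.
pose side e (v : bool) : set R := if v then [set` `]-oo, t e]] else [set` `]t e, +oo[].
have msides e v : measurable (side e v) by case: v; exact: measurable_itv.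
have sideE e v : [set om | (w e om <= t e) = v] = w e @^-1` side e v.
  apply/funext => om; apply/propext; case: v; rewrite /= in_itv//= andbT ltNge.
  by split=> [->|/negbTE].
apply: (prob_bits (xi := fun om e => w e om <= t e)) => [e v|l' v ul'].
  by rewrite sideE; exact: edge_preimage_measurable.
have [_ _ _ indep] := iid; have := indep l' (fun e => side e (v e)) ul' (fun e => msides e (v e)).
have -> : \bigcap_(e in [set e | e \in l']) (w e @^-1` side e (v e)) =
    [set om | {in l', (fun e => w e om <= t e) =1 v}].
  apply/seteqP; split=> om H e el; have := H e el; last by rewrite -sideE.
  by rewrite -sideE.
move=> ->; rewrite -prodEFin; apply: eq_bigr => e _; rewrite /side.
case: (v e); first exact: prob_edge_le.
rewrite (_ : w e @^-1` _ = ~` (w e @^-1` `]-oo, t e])).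
  rewrite probability_setC ?prob_edge_le//.
  by apply: edge_preimage_measurable; exact: measurable_itv.
by apply/seteqP; split=> om /=; rewrite !in_itv/= andbT ltNge => /negP.
Qed.

Lemma prob_slow_has_le (K : eqType) (l : seq K) (F : K -> pred (edge d) -> bool) (n : nat)
    s (q : R) :
  (forall k, k \in l -> depends_on (mem (ball_edges n 0)) (F k)) ->
  (forall k, k \in l ->
     mean (fun=> edge_cdf s) (ball_edges n 0) (fun b => (F k b)%:R) xpred0 <= q) ->
  measurable [set om | has (F^~ (slow_at s om)) l] /\
  (P [set om | has (F^~ (slow_at s om)) l] <= ((size l)%:R * q)%:E)%E.
Proof.
move=> Fdep Fq.
have [|mF PF] := @prob_threshold_event (fun=> s) (ball_edges n 0) (fun b => has (F^~ b) l)
    (uniq_ball_edges _ _).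
  by move=> b b' bb'; apply: eq_in_has => k kl; exact: Fdep.
split; first exact: mF.
rewrite [leLHS]PF lee_fin; apply: le_trans (mean_has_le _ _ _ _ _) _.
  by move=> e; exact: edge_cdf01.
rewrite -sum1_size natr_sum mulr_suml !big_seq; apply: ler_sum => k kl.
by rewrite mul1r Fq.
Qed.

Lemma prob_trapped_box_le (n : nat) s :
  measurable [set om | has (trapped (slow_at s om)) (box n)] /\
  (P [set om | has (trapped (slow_at s om)) (box n)] <=
   (((2 * n + 1) ^ d)%:R * edge_cdf s ^+ (2 * d))%:E)%E.
Proof.
rewrite -size_box.
apply: (@prob_slow_has_le _ _ (fun x b => trapped b x) n.+1) => x /boxP xn.
  by apply: depends_on_sub (@trapped_depends d x); exact: star_sub_ball_edges.
rewrite mean_all ?uniq_star//; last exact: star_sub_ball_edges.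
by rewrite big_const_seq count_predT size_star iter_mulr_1.
Qed.

Lemma mean_nbad_le (n r m : nat) (y : pt d) s b : inbox n y ->
  mean (fun=> edge_cdf s) (ball_edges (n + r) 0) (fun b => (m <= nbad r b y)%N%:R) b <=
  2 ^+ ball_card d r * edge_cdf s ^+ m.
Proof.
move=> yn; have /andP[cdf0 _] := edge_cdf01 s.
rewrite /ball_card -(size_ball_edges r y); apply: mean_count_ge_le => //.
- by move=> e; exact: edge_cdf01.
- exact: uniq_ball_edges.
- exact: ball_edges_sub_box.
Qed.

Lemma prob_crowded_ball_le (r m n : nat) s :
  measurable [set om | crowded_ball r m n (slow_at s om)] /\
  (P [set om | crowded_ball r m n (slow_at s om)] <=
   (((2 * n + 1) ^ d)%:R * (2 ^+ ball_card d r * edge_cdf s ^+ m))%:E)%E.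
Proof.
rewrite -size_box.
apply: (@prob_slow_has_le _ _ (fun y b => m <= nbad r b y)%N (n + r)) => y /boxP yn.
  by apply: depends_on_sub (@nbad_ge_depends d r m y); exact: ball_edges_sub_box.
exact: mean_nbad_le.
Qed.

Lemma prob_crowded_line_le (r m n k : nat) (i : 'I_d) s :
  (1 + 2 ^+ ball_card d r * edge_cdf s ^+ m) ^+ (2 * n + 1) <= 2 ^+ k ->
  measurable [set om | crowded_line r m n (2 * k) i (slow_at s om)] /\
  (P [set om | crowded_line r m n (2 * k) i (slow_at s om)] <=
   (((2 * n + 1) ^ d * (2 * r + 1))%:R / 2 ^+ k)%:E)%E.
Proof.
move=> q_le; have /andP[cdf0 _] := edge_cdf01 s.
have -> : ((2 * n + 1) ^ d * (2 * r + 1))%N =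
    size [seq (x, a) | x <- box (d := d) n, a <- iota 0 (2 * r + 1)].
  by rewrite size_allpairs size_box size_iota.
apply: (@prob_slow_has_le _ _ (fun xa b => 2 * k < line_count r m n xa.2 b xa.1 i)%N (n + r)).
  move=> _ /allpairsP[[x a] /= [/boxP xn _ ->]] b b' bb' /=; congr (_ < _)%N.
  apply: eq_in_count => l; rewrite mem_filter mem_iota => /andP[_ ln].
  apply: (@nbad_ge_depends d r m) => e er; apply: bb'.
  by apply: ball_edges_sub_box er; exact: inbox_line_pt.
move=> _ /allpairsP[[x a] /= [/boxP xn _ ->]] /=.
apply: (mean_count_tail_le _ _ (q := 2 ^+ ball_card d r * edge_cdf s ^+ m)).
- by move=> e; exact: edge_cdf01.
- by rewrite filter_uniq ?iota_uniq.
- by move=> l _; exact: nbad_ge_depends.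
- exact: disjoint_line_balls.
- move=> l; rewrite mem_filter mem_iota => /andP[_ ln].
  by apply: mean_nbad_le; exact: inbox_line_pt.
apply: le_trans q_le; rewrite ler_weXn2l ?lerDl ?mulr_ge0 ?exprn_ge0//.
by rewrite size_filter (leq_trans (count_size _ _))// size_iota.
Qed.

End SlowEdges.

(** * Trapped vertices in disjoint annuli *)

Section Annuli.
Variables (d : nat) (n : nat -> nat).
Hypothesis n_mono : {homo n : j k / (j <= k)%N}.

Definition annulus (N N' : nat) : seq (pt d) := [seq x <- box N' | x \notin box N].

Lemma annulusP N N' (x : pt d) : reflect (inbox N' x /\ ~ inbox N x) (x \in annulus N N').
Proof. by rewrite mem_filter; apply: (iffP andP) => -[/boxP ? /boxP ?]. Qed.

Lemma size_annulus_le N N' : (size (annulus N N') <= (2 * N' + 1) ^ d)%N.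
Proof. by rewrite size_filter (leq_trans (count_size _ _))// size_box. Qed.

(* The inner radius is enlarged by 1 so that distinct blocks share no edge.  *)
Definition block (k : nat) : seq (pt d) := annulus (n k.-1).+1 (n k).

Definition block_edges (k : nat) : seq (edge d) := flatten [seq star x | x <- block k].

Lemma star_sub_block_edges k x : x \in block k -> {subset star x <= block_edges k}.
Proof. by move=> xk e ex; apply/flatten_mapP; exists x. Qed.

Lemma block_edges_disjoint j k e : j != k ->
  e \in block_edges j -> e \notin block_edges k.
Proof.
wlog jk : j k / (j < k)%N => [by_symmetry|_].
  rewrite neq_ltn => /orP[jk|kj] ej; first by apply: by_symmetry ej => //; rewrite ltn_eqF.
  by apply: contraL ej; apply: by_symmetry => //; rewrite ltn_eqF.
move=> /flatten_mapP[x /annulusP[xj _] ex]; apply/negP => /flatten_mapP[x' /annulusP[_ x'k] ex'].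
have nj : (n j <= n k.-1)%N by apply: n_mono; lia.
apply: x'k => i; have := star_close i ex; have := star_close i ex'; have := xj i; lia.
Qed.

Lemma block_edges_sub_ball j k : (j <= k)%N ->
  {subset block_edges j <= ball_edges (n k).+1 0}.
Proof.
move=> /n_mono jk e /flatten_mapP[x /annulusP[xj _]].
by apply: star_sub_ball_edges; exact: inboxW xj.
Qed.

Lemma has_trapped_depends k :
  depends_on (mem (block_edges k)) (fun b => has (trapped b) (block k)).
Proof.
move=> b b' bb'; apply: eq_in_has => x xk; apply: (@trapped_depends d x) => e ex.
by apply: bb'; exact: star_sub_block_edges ex.
Qed.

End Annuli.

Section TrappedBlocks.
Variables (R : realType) (dd : measure_display) (T : measurableType dd).
Variables (P : probability T R) (d : nat) (w : edge d -> T -> R) (e0 : edge d).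
Hypothesis iid : iid_env P w.
Variables (n : nat -> nat) (s : nat -> R).
Hypothesis n_mono : {homo n : j k / (j <= k)%N}.
Let q k := edge_cdf P w e0 (s k) ^+ (2 * d).
Let trapped_in om k := has (trapped (slow (w^~ om) (s k))) (block d n k).

Lemma mean_has_trapped_le (p : edge d -> R) (l : seq (edge d)) (k : nat) :
  (forall e, 0 <= p e <= 1) -> {subset block_edges d n k <= l} ->
  {in block_edges d n k, forall e, p e = edge_cdf P w e0 (s k)} ->
  mean p l (fun b => (has (trapped b) (block d n k))%:R) xpred0 <=
  1 - (1 - q k) ^+ ((2 * n k + 1) ^ d).
Proof.
move=> p01 sub pE; have /andP[cdf0 cdf1] := edge_cdf01 e0 iid (s k).
have q01 : 0 <= 1 - q k <= 1.
  by rewrite subr_ge0 exprn_ile1//= lerBlDr lerDl exprn_ge0.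
have hasE b : has (trapped b) (block d n k) = has (all b) [seq star x | x <- block d n k].
  by rewrite has_map; apply: eq_has => x.
rewrite (eq_mean _ _ _ (fun b => congr1 (fun v : bool => v%:R) (hasE b))).
apply: le_trans (mean_has_all_le _ _ _) _ => //.
  by move=> _ /mapP[x xk ->]; split=> [|e /star_sub_block_edges ek];
    [exact: uniq_star|apply: sub; exact: ek].
rewrite lerD2l lerN2 big_map [leRHS](_ : _ = \prod_(x <- block d n k) (1 - q k)).
  rewrite big_const_seq count_predT iter_mulr_1 ler_wiXn2l ?size_annulus_le//.
    by case/andP: q01.
  by case/andP: q01.
rewrite !big_seq; apply: eq_bigr => x xk; congr (1 - _).
rewrite big_seq (eq_bigr (fun=> edge_cdf P w e0 (s k))); last first.
  by move=> e ex; apply: pE; exact: star_sub_block_edges ex.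
by rewrite -big_seq big_const_seq count_predT size_star iter_mulr_1.
Qed.

Lemma prob_trapped_blocks_le (a m : nat) :
  measurable [set om | all (trapped_in om) (iota a m)] /\
  (P [set om | all (trapped_in om) (iota a m)] <=
   (\prod_(k <- iota a m) (1 - (1 - q k) ^+ ((2 * n k + 1) ^ d)))%:E)%E.
Proof.
pose t e := \sum_(k < a + m | e \in block_edges d n k) s k.
have iota_lt k : k \in iota a m -> (k < a + m)%N by rewrite mem_iota => /andP[].
have tE k e : k \in iota a m -> e \in block_edges d n k -> t e = s k.
  move=> /iota_lt km ek; rewrite /t (bigD1 (Ordinal km))//= big1 ?addr0// => j /andP[ej jk].
  by have := block_edges_disjoint n_mono jk ej; rewrite ek.
pose N := (n (a + m)).+1.
have sub k : k \in iota a m -> {subset block_edges d n k <= ball_edges N 0}.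
  by move=> /iota_lt/ltnW; exact: block_edges_sub_ball.
pose F b := all (fun k => has (trapped b) (block d n k)) (iota a m).
have FE om : all (trapped_in om) (iota a m) = F (fun e => w e om <= t e).
  apply: eq_in_all => k km; apply: has_trapped_depends => e ek.
  by rewrite /slow (tE k).
have Fprod b : (F b)%:R = \prod_(k <- iota a m) (has (trapped b) (block d n k))%:R :> R.
  rewrite /F; elim: (iota a m) => [|k l IH] /=; first by rewrite big_nil.
  by rewrite big_cons -IH; case: (has _ _); rewrite ?mul1r ?mul0r.
have Fdep : depends_on (mem (ball_edges N 0)) F.
  move=> b b' bb'; apply: eq_in_all => k km; apply: has_trapped_depends => e ek.
  by apply: bb'; exact: sub ek.
have [mF PF] := prob_threshold_event e0 iid t (uniq_ball_edges _ _) Fdep.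
have -> : [set om | all (trapped_in om) (iota a m)] = [set om | F (fun e => w e om <= t e)].
  by apply/funext => om; rewrite /= FE.
split=> //; rewrite PF lee_fin (eq_mean _ _ _ Fprod).
have disj : disjoint_family (iota a m) (fun k => mem (block_edges d n k)).
  by move=> j k e _ _; exact: block_edges_disjoint.
rewrite (mean_prod _ _ _ (iota_uniq a m) _ disj); last first.
  by move=> k _; apply: (depends_on_comp (fun v : bool => v%:R)); exact: has_trapped_depends.
have cdf01 e : 0 <= (edge_cdf P w e0 \o t) e <= 1 by exact: edge_cdf01.
rewrite big_seq [leRHS]big_seq; apply: ler_prod => k km; rewrite mean_ge0//=.
by apply: mean_has_trapped_le => //; [exact: sub|move=> e ek; rewrite /= (tE k)].
Qed.

End TrappedBlocks.

Section BorelCantelli.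
Variables (R : realType) (dd : measure_display) (T : measurableType dd).
Variable P : probability T R.

Lemma prob_bigcup_seq_le (I : choiceType) (l : seq I) (F : I -> set T) (q : I -> R) :
  (forall j, j \in l -> measurable (F j) /\ (P (F j) <= (q j)%:E)%E) ->
  measurable (\bigcup_(j in [set` l]) F j) /\
  (P (\bigcup_(j in [set` l]) F j) <= (\sum_(j <- l) q j)%:E)%E.
Proof.
rewrite bigcup_seq; elim: l => [_|j l IH Fq].
  by rewrite !big_nil measure0.
have [mFj PFj] := Fq j (mem_head _ _).
have [mFl PFl] := IH (fun k kl => Fq k (mem_behead (s := j :: l) kl)).
rewrite !big_cons; split; first exact: measurableU.
by rewrite EFinD; apply: le_trans (measureU2 _ mFj mFl) _; exact: leeD.
Qed.

Lemma ae_eventually_not (F : nat -> set T) (q : nat -> R) :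
  (forall k, measurable (F k) /\ (P (F k) <= (q k)%:E)%E) ->
  (\forall k \near \oo, q k <= 2 ^- k) ->
  {ae P, forall om, \forall k \near \oo, ~ F k om}.
Proof.
move=> /all_and2[mF PF] [k0 _ qk]; pose G k := F (k0 + k)%N.
exists (lim_sup_set G); split.
- by apply: bigcap_measurable => // k _; apply: bigcup_measurable => j _; exact: mF.
- apply: lim_sup_set_cvg0 => [k|]; first exact: mF.
  apply: le_lt_trans (_ : ((2 : R)%R%:E < +oo)%E); last exact: ltry.
  apply: le_trans (@epsilon_trick0 R 2%R xpredT (ler0n _ _)).
  apply: lee_nneseries => [k _ _|k _]; first exact: measure_ge0.
  apply: le_trans (PF _) _; rewrite lee_fin (le_trans (qk _ (leq_addr _ _)))//.
  rewrite natrX exprS invfM mulrA divff// mul1r.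
  by rewrite exprD invfM ler_piMl ?invr_ge0 ?exprn_ge0// invf_le1 ?exprn_ege1 ?ler1n ?exprn_gt0.
- move=> om /= often k _; apply: contrapT => never; apply: often.
  exists (k0 + k)%N => // j /= kj Fj; apply: never; exists (j - k0)%N => /=; first by lia.
  by rewrite /G subnKC//; lia.
Qed.

Lemma ae_frequently_not (V : nat -> set T) (k0 : nat) (u : nat -> nat -> R) :
  (forall a m, (k0 <= a)%N ->
     measurable [set om | forall k, k \in iota a m -> V k om] /\
     (P [set om | forall k, k \in iota a m -> V k om] <= (u a m)%:E)%E) ->
  (forall a, u a m @[m --> \oo] --> 0) ->
  {ae P, forall om, forall a, exists2 k, (a <= k)%N & ~ V k om}.
Proof.
move=> PV u0; apply: ae_foralln => a0.
pose a := maxn k0 a0; have ka : (k0 <= a)%N by exact: leq_maxl.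
pose N := \bigcap_m [set om | forall k, k \in iota a m -> V k om].
have mN : measurable N by apply: bigcap_measurable => // m _; have [] := PV a m ka.
exists N; split=> //.
- apply/eqP; rewrite eq_le measure_ge0 andbT; apply/lee_addgt0Pr => e e0; rewrite add0e.
  have [m _ /(_ m (leqnn m)) um] := cvgr_le _ (u0 a) e e0.
  have [mV PVm] := PV a m ka.
  apply: (@le_trans _ _ (P [set om | forall k, k \in iota a m -> V k om])).
    by apply: le_measure; rewrite ?inE// => om; apply.
  by apply: le_trans PVm _; rewrite lee_fin.
- move=> om /= not_freq m _ k; rewrite /= mem_iota => /andP[ak _].
  apply: contrapT => nV; apply: not_freq.
  by exists k => //; exact: leq_trans (leq_maxr _ _) ak.
Qed.

End BorelCantelli.

(** * Decay of the speed function *)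

Section SpeedFunction.
Variable R : realType.
Implicit Types (q g : R -> R) (c u v : R).

Definition almost_decreasing c u0 q : Prop :=
  forall u v, u0 <= u -> u <= v -> c * q v <= q u.

Lemma near_pinfty_ge (Q : R -> Prop) : (\forall u \near +oo, Q u) ->
  exists2 u0, 0 < u0 & forall u, u0 <= u -> Q u.
Proof.
move=> [M [_ HM]]; exists (Num.max 1 (M + 1)); first by rewrite lt_max ltr01.
by move=> u; rewrite ge_max => /andP[_ Mu]; apply: HM; lra.
Qed.

Lemma exists_dyadic_le u v : 0 < u -> u <= v ->
  exists j, 2 ^+ j * u <= v /\ v <= 2 * (2 ^+ j * u).
Proof.
move=> u0 uv; pose m := Num.truncn (v / u).
have m0 : (0 < m)%N by rewrite truncn_gt0 ler_pdivlMr// mul1r.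
have /andP[jm mj] := trunc_log_bounds (ltnSn 1) m0.
have vu : 0 <= v / u by rewrite divr_ge0 ?(le_trans _ uv) ?ltW.
exists (trunc_log 2 m); split.
  rewrite -ler_pdivlMr// (le_trans (_ : _ <= m%:R)) ?truncn_le//.
  by rewrite -natrX ler_nat.
rewrite mulrA -exprS -ler_pdivrMr// (le_trans (ltW (truncnS_gt _)))//.
by rewrite -natrX ler_nat.
Qed.

Section Doubling.
Variables (q : R -> R) (u0 kappa A : R).
Hypothesis u0_gt0 : 0 < u0.
Hypothesis kappa01 : 0 <= kappa < 1.
Hypothesis A_gt0 : 0 < A.
Hypothesis q_ge0 : forall u, u0 <= u -> 0 <= q u.
Hypothesis q_double : forall u, u0 <= u -> q (2 * u) <= kappa * q u.
Hypothesis q_within_double : forall u v, u0 <= u -> u <= v -> v <= 2 * u -> q v <= A * q u.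

Lemma dyadic_ge (j : nat) u : u0 <= u -> u0 <= 2 ^+ j * u.
Proof.
by move=> u0u; rewrite (le_trans u0u)// ler_peMl ?exprn_ege1 ?ler1n// (le_trans _ u0u)// ltW.
Qed.

Lemma doubling_dyadic_le (j : nat) u : u0 <= u -> q (2 ^+ j * u) <= kappa ^+ j * q u.
Proof.
have /andP[k0 _] := kappa01; move=> u0u; elim: j => [|j IH]; first by rewrite !expr0 !mul1r.
rewrite !exprS -!mulrA (le_trans (q_double (dyadic_ge j u0u)))//.
by rewrite ler_wpM2l.
Qed.

Lemma doubling_almost_decreasing : almost_decreasing A^-1 u0 q.
Proof.
have /andP[k0 k1] := kappa01; move=> u v u0u uv; rewrite ler_pdivrMl//.
have [j [ju uj]] := exists_dyadic_le (lt_le_trans u0_gt0 u0u) uv.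
apply: le_trans (q_within_double (dyadic_ge j u0u) ju uj) _; rewrite ler_pM2l//.
apply: le_trans (doubling_dyadic_le j u0u) _.
by rewrite ler_piMl ?exprn_ile1 ?q_ge0// ltW.
Qed.

Lemma doubling_cvg0 : q u @[u --> +oo] --> 0.
Proof.
have /andP[k0 k1] := kappa01.
apply/cvgr0Pnorm_le => e e0.
have cvg_bound : A * (kappa ^+ j * q u0) @[j --> \oo] --> 0.
  rewrite -(mulr0 A) -(mul0r (q u0)); apply: cvgM (cvg_cst _) (cvgM _ (cvg_cst _)).
  by apply: cvg_expr; rewrite ger0_norm.
have [j _ /(_ j (leqnn j)) bound_j] := cvgr_le _ cvg_bound e e0.
near=> v.
have jv : 2 ^+ j * u0 <= v by near: v; apply: nbhs_pinfty_ge; rewrite num_real.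
have u0j := dyadic_ge j (lexx u0).
rewrite ger0_norm ?q_ge0 ?(le_trans u0j)//; apply: le_trans bound_j.
have := doubling_almost_decreasing u0j jv; rewrite ler_pdivrMl// => /le_trans; apply.
by rewrite ler_pM2l// doubling_dyadic_le.
Unshelve. all: by end_near. Qed.

End Doubling.

Lemma reg_var_double_le g rho : (forall u, 0 < u -> 0 < g u) ->
  rho < -2 -> reg_var g rho ->
  exists2 kappa, 0 <= kappa < 1 & exists2 u0, 0 < u0 &
    forall u, u0 <= u -> (2 * u) ^+ 2 * g (2 * u) <= kappa * (u ^+ 2 * g u).
Proof.
move=> g_gt0 rho2 /(_ 2 (ltr0n _ 2)); set A := 2 `^ (- rho).
have A4 : 4 < A.
  have -> : 4 = 2 `^ 2 :> R by rewrite powR_mulrn// -natrX.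
  by rewrite /A /powR pnatr_eq0/= ltr_expR ltr_pM2r ?ln_gt0 ?ltr1n//; lra.
have A0 : 0 < A by lra.
move=> ratio; have ratio_lt : 1 < (A + 4) / 8 by lra.
have [u0 u00 ratio_le] := near_pinfty_ge (cvgr_le _ ratio _ ratio_lt).
exists ((A + 4) / (2 * A)).
  by rewrite divr_ge0 ?ltr_pdivrMr ?mulr_gt0//; lra.
exists u0 => // u u0u; have up : 0 < u by exact: lt_le_trans u0u.
have pu : 0 < u `^ (- rho) by rewrite powR_gt0.
have g_le : g (2 * u) * A <= (A + 4) / 8 * g u.
  have := ratio_le u u0u; rewrite (powRM _ (ler0n _ 2) (ltW up)) -/A.
  by rewrite ler_pdivrMr ?mulr_gt0 ?g_gt0// mulrA [leRHS]mulrA ler_pM2r.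
have -> : (2 * u) ^+ 2 * g (2 * u) = 4 * u ^+ 2 / A * (g (2 * u) * A).
  by field; rewrite gt_eqF.
have -> : (A + 4) / (2 * A) * (u ^+ 2 * g u) = 4 * u ^+ 2 / A * ((A + 4) / 8 * g u).
  by field; rewrite gt_eqF.
by rewrite ler_wpM2l// divr_ge0 ?mulr_ge0 ?sqr_ge0// ltW.
Qed.

Lemma speed_decay g : (forall u, 0 < u -> 0 < g u) ->
  (forall u v, 0 < u -> u <= v -> g v <= g u) ->
  (exists rho : R, rho < -2 /\ reg_var g rho) \/ mono_to_zero (fun u => u ^+ 2 * g u) ->
  exists c u0, [/\ 0 < c, 0 < u0, almost_decreasing c u0 (fun u => u ^+ 2 * g u) &
    u ^+ 2 * g u @[u --> +oo] --> 0].
Proof.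
move=> g_gt0 g_mono [[rho [rho2 g_reg]]|[q_mono q_cvg0]]; last first.
  exists 1, 1; split=> // u v u1 uv.
  by rewrite mul1r q_mono// (lt_le_trans _ u1).
have [kappa kappa01 [u0 u0p q_double]] := reg_var_double_le g_gt0 rho2 g_reg.
have q_ge0 u : u0 <= u -> 0 <= u ^+ 2 * g u.
  by move=> u0u; rewrite mulr_ge0 ?sqr_ge0// ltW// g_gt0// (lt_le_trans u0p).
have q_within u v : u0 <= u -> u <= v -> v <= 2 * u ->
    v ^+ 2 * g v <= 4 * (u ^+ 2 * g u).
  move=> u0u uv vu; have up : 0 < u by exact: lt_le_trans u0u.
  have -> : 4 * (u ^+ 2 * g u) = (2 * u) ^+ 2 * g u by ring.
  have vp := lt_le_trans up uv.
  apply: ler_pM; [exact: sqr_ge0|exact: ltW (g_gt0 _ vp)| |exact: g_mono].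
  by rewrite ler_sqr ?nnegrE ?mulr_ge0 ?(ltW up) ?(ltW vp).
exists 4^-1, u0; split=> //.
  exact: (doubling_almost_decreasing (kappa := kappa)).
exact: (@doubling_cvg0 _ u0 kappa 4).
Qed.

Lemma speed_rescale g c u0 (C : R) : (forall u, 0 < u -> 0 < g u) -> 0 < c -> 0 < u0 -> 0 < C ->
  almost_decreasing c u0 (fun u => u ^+ 2 * g u) ->
  exists2 A, 1 <= A & forall u, u0 <= u -> C * g (A * u) <= g u.
Proof.
move=> g_gt0 c0 u00 C0 decr; pose A := Num.max 1 (C / c).
have A1 : 1 <= A by rewrite le_max lexx.
have A0 : 0 < A by exact: lt_le_trans A1.
have CA : C <= c * A ^+ 2.
  have : C / c <= A by rewrite le_max lexx orbT.
  rewrite ler_pdivrMr// mulrC => /le_trans; apply; rewrite ler_pM2l//.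
  by rewrite expr2 ler_peMl// ltW.
exists A => // u u0u; have up : 0 < u by exact: lt_le_trans u0u.
have := decr u (A * u) u0u (ler_peMl (ltW up) A1).
rewrite exprMn (_ : c * _ = u ^+ 2 * (c * A ^+ 2 * g (A * u))); last by ring.
rewrite ler_pM2l ?exprn_gt0//; apply: le_trans.
by rewrite ler_wpM2r// ltW// g_gt0// mulr_gt0.
Qed.

End SpeedFunction.

(** * Asymptotics along the scales 2 ^ (4 k ^ 2) *)

Definition scale (k : nat) : nat := (2 ^ (4 * k ^ 2))%N.

Lemma scale_gt0 k : (0 < scale k)%N.
Proof. by rewrite expn_gt0. Qed.

Lemma leq_scale : {homo scale : j k / (j <= k)%N}.
Proof. by move=> j k jk; rewrite leq_pexp2l// leq_mul2l /= leq_exp2r. Qed.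

Lemma leq_id_scale k : (k <= scale k)%N.
Proof. by rewrite (leq_trans (ltnW (ltn_expl k (ltnSn 1))))// leq_exp2l//; nia. Qed.

Lemma leq_sqr_pow2 k : (4 <= k)%N -> (k ^ 2 <= 2 ^ k)%N.
Proof.
elim: k => // k IH; rewrite leq_eqVlt => /predU1P[<-//|k4].
by have := IH k4; rewrite (expnS 2 k) -!mulnn; move: (2 ^ k)%N => t; nia.
Qed.

Section Powers.
Variable R : realType.

Lemma scaleE k : (scale k)%:R = 2 ^+ (4 * k ^ 2) :> R.
Proof. by rewrite natrX. Qed.

Lemma natr_le_pow2 (k : nat) : k%:R <= 2 ^+ k :> R.
Proof. by rewrite -natrX ler_nat ltnW// ltn_expl. Qed.

Lemma natr_scale_cvgy : (scale k)%:R @[k --> \oo] --> (+oo : set_system R).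
Proof.
apply/cvgryPge => B; near=> k; rewrite (@le_trans _ _ k%:R) ?ler_nat ?leq_id_scale//.
by near: k; exact: nbhs_infty_ger.
Unshelve. all: by end_near. Qed.

Lemma pow2_cvgy : 2 ^+ k @[k --> \oo] --> (+oo : set_system R).
Proof.
apply/cvgryPge => B; near=> k; apply: le_trans (natr_le_pow2 k).
by near: k; exact: nbhs_infty_ger.
Unshelve. all: by end_near. Qed.

Lemma mul_pow2_le (a b : R) (m n k : nat) : 0 <= a -> 0 <= b ->
  a <= 2 ^+ m -> b <= 2 ^- n -> (m + k <= n)%N -> a * b <= 2 ^- k.
Proof.
move=> a0 b0 am bn mkn; apply: le_trans (ler_pM a0 b0 am bn) _.
rewrite ler_pdivrMr ?exprn_gt0// mulrC ler_pdivlMr ?exprn_gt0// -exprD.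
by rewrite ler_eXn2l ?ltr1n.
Qed.

(* The factor 1 / 2 is a lower bound for ln 2.                               *)
Lemma expr_1D_le_pow2 (q : R) (n l : nat) : 0 <= q -> n%:R * q <= l%:R / 2 ->
  (1 + q) ^+ n <= 2 ^+ l.
Proof.
move=> q0 nq; apply: (@le_trans _ _ (expR q ^+ n)).
  by rewrite lerXn2r ?nnegrE ?addr_ge0 ?expR_ge0 ?expR_ge1Dx.
rewrite -expRM_natl (@le_trans _ _ (expR (l%:R * 2^-1)))// ?ler_expR// expRM_natl.
rewrite lerXn2r ?nnegrE ?expR_ge0// -[2^-1]opprK expRN -[leRHS]invrK.
rewrite lef_pV2 ?posrE ?invr_gt0 ?expR_gt0//.
by have := expR_ge1Dx (- 2^-1 : R); lra.
Qed.

Lemma expR_le_oneB (a : R) : 0 <= a -> a <= 2^-1 -> expR (- (2 * a)) <= 1 - a.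
Proof.
move=> a0 a2; rewrite expRN -[leLHS]div1r ler_pdivrMr ?expR_gt0//.
apply: (@le_trans _ _ ((1 - a) * (1 + 2 * a))); first by nra.
by rewrite ler_wpM2l ?expR_ge1Dx//; lra.
Qed.

Lemma sum_pow2V_le (a b : nat) : \sum_(a <= j < b) 2 ^- j <= 2 * 2 ^- a :> R.
Proof.
have [ab|/ltnW ba] := leqP a b; last by rewrite big_geq ?mulr_ge0 ?invr_ge0 ?exprn_ge0.
suff -> : \sum_(a <= j < b) 2 ^- j = 2 * 2 ^- a - 2 * 2 ^- b :> R.
  by rewrite gerBl mulr_ge0 ?invr_ge0 ?exprn_ge0.
rewrite addrC -[2 * 2 ^- a]opprK -(telescope_sumr (fun j => - (2 * 2 ^- j)))//.
by apply: eq_bigr => j _; rewrite exprS invfM mulVKf//; ring.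
Qed.

Lemma prod_pred_div (a m : nat) : (0 < a)%N ->
  \prod_(k <- iota a.+1 m) (k.-1%:R / k%:R) = a%:R / (a + m)%:R :> R.
Proof.
move=> a0; elim: m => [|m IH]; first by rewrite big_nil addn0 divff// pnatr_eq0 -lt0n.
rewrite -[m.+1]addn1 iotaD big_cat IH big_seq1 addSn/= mulrA divfK ?addn1 ?addnS//.
by rewrite pnatr_eq0; lia.
Qed.

End Powers.

(* At level j we tolerate 2 * 2 ^ (line_exponent k j) = scale k / 2 ^ (3 j)  *)
(* crowded balls on a line.                                                  *)
Definition line_exponent (k j : nat) : nat := (4 * k ^ 2 - 3 * j).-1.

Lemma line_exponentS k j : (j < k ^ 2)%N -> (line_exponent k j).+1 = (4 * k ^ 2 - 3 * j)%N.
Proof. by rewrite /line_exponent => jk; rewrite prednK//; lia. Qed.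

Lemma line_exponentE (R : numFieldType) k j : (j < k ^ 2)%N ->
  (2 * 2 ^ line_exponent k j)%:R = (scale k)%:R / 2 ^+ (3 * j) :> R.
Proof.
move=> jk; have jk3 : (3 * j <= 4 * k ^ 2)%N by lia.
rewrite -expnS line_exponentS// !natrX -[in RHS](subnK jk3).
by rewrite exprD mulfK// expf_neq0.
Qed.

Section ScaleCardinals.
Variables (R : realType) (d : nat).

Lemma ln_scale_le k : (2 <= k)%N -> ln (scale k)%:R <= k%:R ^+ 4 :> R.
Proof.
move=> k2; have ln2 : ln 2 <= 1 :> R.
  by have := @expR_ge1Dx R (ln 2); rewrite lnK ?posrE//; lra.
rewrite scaleE lnXn// (@le_trans _ _ (4 * k ^ 2)%:R)//.
  by rewrite -[leLHS]mulr_natr ler_piMl ?ler0n.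
by rewrite -natrX ler_nat (expnD k 2 2) leq_mul2r -[4%N]/(2 ^ 2)%N leq_exp2r// k2 orbT.
Qed.

Lemma box_card_le (n m : nat) : (2 * n + 1 <= 2 ^ m)%N ->
  ((2 * n + 1) ^ d)%:R <= 2 ^+ (m * d) :> R.
Proof. by move=> nm; rewrite exprM natrX lerXn2r ?nnegrE ?exprn_ge0// -natrX ler_nat. Qed.

Lemma side_scale_le k : (2 * (2 * scale k) + 1 <= 2 ^ (4 * k ^ 2 + 3))%N.
Proof. by rewrite expnD -/(scale k); have := scale_gt0 k; lia. Qed.

Lemma crowded_line_bound (j0 M : nat) : \forall k \near \oo,
  \sum_(j0 <= j < k ^ 2)
    (((2 * (2 * scale k) + 1) ^ d * M)%:R / 2 ^+ (2 ^ line_exponent k j)) <= 2 ^- k :> R.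
Proof.
near=> k; have kM : (3 * d + M + 3 <= k)%N by near: k; exact: nbhs_infty_ge.
apply: (@le_trans _ _ (\sum_(j0 <= j < k ^ 2) 2 ^- (k ^ 2 + k))).
  rewrite !big_nat; apply: ler_sum => j /andP[_ jk].
  apply: (mul_pow2_le (m := (4 * k ^ 2 + 3) * d + M) (n := 2 ^ line_exponent k j)) => //.
  - by rewrite natrM exprD ler_pM// ?box_card_le ?side_scale_le ?natr_le_pow2.
  have jk2 : (k ^ 2 <= line_exponent k j)%N by rewrite /line_exponent; lia.
  have kk : (4 <= k ^ 2)%N by nia.
  apply: leq_trans (leq_trans (leq_sqr_pow2 kk) _); last by rewrite leq_exp2l.
  have [dK kK] : (4 * d + 3 <= k ^ 2)%N /\ (k <= k ^ 2)%N by split; nia.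
  by move: (k ^ 2)%N dK kK => K dK kK; have := leq_mul dK (leqnn K); rewrite -mulnn; lia.
rewrite sumr_const_nat -[leLHS]mulr_natl exprD invfM mulrA ler_piMl ?invr_ge0 ?exprn_ge0//.
rewrite ler_pdivrMr ?exprn_gt0// mul1r (le_trans _ (natr_le_pow2 _ _))//.
by rewrite ler_nat leq_subr.
Unshelve. all: by end_near. Qed.

End ScaleCardinals.

Section ScaleBounds.
Variables (R : realType) (d : nat) (p g : R -> R).
Hypothesis d_ge2 : (2 <= d)%N.
Hypothesis p01 : forall s, 0 <= p s <= 1.
Hypothesis p_small : forall e, 0 < e ->
  \forall u \near +oo, u ^+ d * p (g u) ^+ (2 * d) <= e * ln (ln u).
Local Notation N k := ((scale k)%:R : R).

Let p_ge0 s : 0 <= p s.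
Proof. by case/andP: (p01 s). Qed.

Let p_le1 s : p s <= 1.
Proof. by case/andP: (p01 s). Qed.

Lemma prob_dyadic_le : \forall j \near \oo, p (g (2 ^+ j)) ^+ (2 * d) <= 2 ^- j.
Proof.
have small := @pow2_cvgy R _ (p_small ltr01); near=> j.
have j0 : (0 < j)%N by near: j; exact: nbhs_infty_gt.
have : (2 ^+ j) ^+ d * p (g (2 ^+ j)) ^+ (2 * d) <= 1 * ln (ln (2 ^+ j)) by near: j; exact: small.
set u := 2 ^+ j; have u1 : 1 < u by rewrite exprn_egt1 ?ltr1n// -lt0n.
have u0' : 0 < u by exact: lt_trans u1.
have llu : ln (ln u) <= u.
  have lnu0 : 0 < ln u by rewrite ln_gt0.
  by rewrite (le_trans (ltW (ln_sublinear lnu0)))// ltW// ln_sublinear.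
rewrite mul1r => /le_trans/(_ llu) small_u.
have : u ^+ 2 * p (g u) ^+ (2 * d) <= u.
  by apply: le_trans small_u; rewrite ler_wpM2r ?exprn_ge0// ler_weXn2l// ltW.
by rewrite expr2 -mulrA -[leRHS]mulr1 ler_pM2l// -ler_pdivlMl// mulr1.
Unshelve. all: by end_near. Qed.

Lemma prob_dyadic_pow_le (h : nat) : \forall j \near \oo,
  p (g (2 ^+ j)) ^+ (2 * d * h) <= 2 ^- (j * h).
Proof.
apply: filterS prob_dyadic_le => j dyadic.
rewrite (exprM _ (2 * d)) (exprM _ j) -exprVn.
by rewrite lerXn2r ?nnegrE ?exprn_ge0 ?invr_ge0.
Qed.

Lemma crowded_ball_dyadic_bound (B h : nat) : (4 * d + 4 <= h)%N -> \forall k \near \oo,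
  ((2 * (2 * scale k) + 1) ^ d)%:R * (2 ^+ B * p (g (2 ^+ (k ^ 2))) ^+ (2 * d * h)) <= 2 ^- k.
Proof.
move=> dh; have [j1 _ dyadic] := prob_dyadic_pow_le h; near=> k.
have kB : (3 * d + B + j1 <= k)%N by near: k; exact: nbhs_infty_ge.
rewrite mulrA; apply: (mul_pow2_le (m := (4 * k ^ 2 + 3) * d + B) (n := k ^ 2 * h)).
- by rewrite mulr_ge0 ?ler0n ?exprn_ge0.
- exact: exprn_ge0.
- by rewrite exprD ler_wpM2r ?exprn_ge0// box_card_le// side_scale_le.
- by apply: dyadic => /=; nia.
nia.
Unshelve. all: by end_near. Qed.

Lemma line_moment_le (B h : nat) : (4 <= h)%N -> \forall j \near \oo, forall k, (j < k ^ 2)%N ->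
  (1 + 2 ^+ B * p (g (2 ^+ j)) ^+ (2 * d * h)) ^+ (2 * (2 * scale k) + 1) <=
  2 ^+ (2 ^ line_exponent k j).
Proof.
move=> h4; have dyadic := prob_dyadic_pow_le h; near=> j => k jk.
have jB : (B + 5 <= j)%N by near: j; exact: nbhs_infty_ge.
set q := 2 ^+ B * _; have q0 : 0 <= q by rewrite mulr_ge0 ?exprn_ge0.
apply: expr_1D_le_pow2 => //.
have q_le : q <= 2 ^- (3 * j + 5).
  apply: (mul_pow2_le (m := B) (n := j * h)); rewrite ?exprn_ge0//; last by nia.
  by near: j; exact: dyadic.
have side_le : (2 * (2 * scale k) + 1)%:R <= 2 ^+ (4 * k ^ 2 + 3) :> R.
  by rewrite -natrX ler_nat side_scale_le.
apply: le_trans (ler_pM (ler0n _ _) q0 side_le q_le) _.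
rewrite natrX ler_pdivrMr ?exprn_gt0// mulrAC ler_pdivlMr// -exprSr -exprD.
by rewrite ler_eXn2l ?ltr1n//; have := line_exponentS jk; lia.
Unshelve. all: by end_near. Qed.

Section AlmostDecreasing.
Variables c u0 : R.
Hypothesis p_mono : {homo p : s s' / s <= s'}.
Hypothesis g_gt0 : forall u, 0 < u -> 0 < g u.
Hypothesis c_gt0 : 0 < c.
Hypothesis u0_gt0 : 0 < u0.
Hypothesis g_decr : almost_decreasing c u0 (fun u => u ^+ 2 * g u).

Lemma prob_scale_le (C e : R) : 0 < C -> 0 < e ->
  \forall k \near \oo, N k ^+ d * p (C * g (N k)) ^+ (2 * d) <= e * ln k%:R.
Proof.
move=> C0 e0; have [A A1 gA] := speed_rescale g_gt0 c_gt0 u0_gt0 C0 g_decr.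
have A0 : 0 < A by exact: lt_le_trans A1.
have e'0 : 0 < e / (4 * A ^+ d) by rewrite divr_gt0// mulr_gt0// exprn_gt0.
have [M M0 small] := near_pinfty_ge (p_small e'0).
near=> k; have k2 : (2 <= k)%N by near: k; exact: nbhs_infty_ge.
have kp : 0 < k%:R :> R by rewrite ltr0n ltnW.
pose u := N k / A; have Nu : N k = A * u by rewrite /u mulrC divfK// gt_eqF.
have [Mu u0u eu] : [/\ M <= u, u0 <= u & expR 1 <= u].
  have : Num.max (Num.max M u0) (expR 1) * A <= N k.
    by near: k; have /cvgryPge := @natr_scale_cvgy R; exact.
  by rewrite -ler_pdivlMr// !ge_max => /andP[/andP[? ?] ?].
have up : 0 < u by exact: lt_le_trans u0u.
have p_le : p (C * g (N k)) ^+ (2 * d) <= p (g u) ^+ (2 * d).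
  by rewrite lerXn2r ?nnegrE// p_mono// Nu gA.
have lnu : 1 <= ln u by rewrite -(expRK 1) ler_ln ?posrE ?expR_gt0.
have lnln_le : ln (ln u) <= 4 * ln k%:R.
  rewrite mulr_natl -lnXn// ler_ln ?posrE ?exprn_gt0 ?(lt_le_trans _ lnu)//.
  apply: le_trans (ln_scale_le R k2); rewrite ler_ln ?posrE ?ltr0n ?scale_gt0//.
  by rewrite Nu ler_peMl// ltW.
rewrite {1}Nu exprMn -mulrA.
apply: (@le_trans _ _ (A ^+ d * (u ^+ d * p (g u) ^+ (2 * d)))).
  by rewrite !ler_wpM2l ?exprn_ge0 ?(ltW A0) ?(ltW up).
rewrite -ler_pdivlMl ?exprn_gt0// (le_trans (small u Mu))//.
apply: le_trans (ler_wpM2l (ltW e'0) lnln_le) _.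
by rewrite le_eqVlt; apply/predU1P; left; field; rewrite expf_neq0// gt_eqF.
Unshelve. all: by end_near. Qed.

Lemma prob_scale_expr_le (C : R) : 0 < C ->
  \forall k \near \oo, p (C * g (N k)) ^+ (2 * d) <= 2 ^- (4 * k ^ 2 * d - k).
Proof.
move=> C0; have level := prob_scale_le C0 ltr01; near=> k.
have k1 : (0 < k)%N by near: k; exact: nbhs_infty_gt.
have : N k ^+ d * p (C * g (N k)) ^+ (2 * d) <= 1 * ln k%:R by near: k; exact: level.
have lnk : ln k%:R <= 2 ^+ k :> R.
  by rewrite (le_trans (ltW (ln_sublinear _))) ?ltr0n// natr_le_pow2.
rewrite mul1r => /le_trans/(_ lnk) small.
have kd : (k <= 4 * k ^ 2 * d)%N by nia.
have N_pow : N k ^+ d = 2 ^+ (4 * k ^ 2 * d - k) * 2 ^+ k.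
  by rewrite scaleE -exprM -exprD subnK.
move: small; rewrite N_pow mulrAC -ler_pdivlMr ?exprn_gt0// divff ?expf_neq0//.
by rewrite mulrC -ler_pdivlMr ?exprn_gt0// div1r.
Unshelve. all: by end_near. Qed.

Lemma prob_scale_le_pow2 (C : R) : 0 < C ->
  \forall k \near \oo, p (C * g (N k)) <= 2 ^- (3 * k).
Proof.
move=> C0; have level := prob_scale_expr_le C0; near=> k.
have k3 : (3 <= k)%N by near: k; exact: nbhs_infty_ge.
have d0 : (0 < 2 * d)%N by lia.
rewrite -(ler_pXn2r d0) ?nnegrE ?invr_ge0 ?exprn_ge0//.
apply: (@le_trans _ _ (2 ^- (4 * k ^ 2 * d - k))); first by near: k; exact: level.
rewrite exprVn -exprM lef_pV2 ?posrE ?exprn_gt0// ler_eXn2l ?ltr1n//; nia.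
Unshelve. all: by end_near. Qed.

Lemma inner_trapped_bound (C : R) : 0 < C -> \forall k \near \oo,
  ((2 * (scale k.-1).+1 + 1) ^ d)%:R * p (C * g (N k)) ^+ (2 * d) <= 2 ^- k.
Proof.
move=> C0; have level := prob_scale_expr_le C0; near=> k.
have k4 : (4 <= k)%N by near: k; exact: nbhs_infty_ge.
apply: (mul_pow2_le (m := (4 * k.-1 ^ 2 + 3) * d) (n := 4 * k ^ 2 * d - k)).
- exact: ler0n.
- exact: exprn_ge0.
- by apply: box_card_le; rewrite expnD -/(scale k.-1); have := scale_gt0 k.-1; lia.
- by near: k; exact: level.
case: (k) k4 => // j j4 /=; nia.
Unshelve. all: by end_near. Qed.

Lemma crowded_ball_bound (C : R) (B : nat) : 0 < C -> \forall k \near \oo,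
  ((2 * (2 * scale k) + 1) ^ d)%:R * (2 ^+ B * p (C * g (N k)) ^+ (2 * d).+1) <= 2 ^- k.
Proof.
move=> C0; have level := prob_scale_expr_le C0; have level1 := prob_scale_le_pow2 C0; near=> k.
have kB : (3 * d + B <= k)%N by near: k; exact: nbhs_infty_ge.
rewrite mulrA; apply: (mul_pow2_le (m := (4 * k ^ 2 + 3) * d + B)
  (n := (4 * k ^ 2 * d - k) + 3 * k)).
- by rewrite mulr_ge0 ?ler0n ?exprn_ge0.
- exact: exprn_ge0.
- by rewrite exprD ler_wpM2r ?exprn_ge0// box_card_le// side_scale_le.
- rewrite exprSr exprD invfM; apply: ler_pM => //; rewrite ?exprn_ge0//.
    by near: k; exact: level.
  by near: k; exact: level1.
nia.
Unshelve. all: by end_near. Qed.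

Lemma annulus_trapped_bound (C : R) : 0 < C -> \forall k \near \oo,
  1 - (1 - p (C * g (N k)) ^+ (2 * d)) ^+ ((2 * scale k + 1) ^ d) <= k.-1%:R / k%:R.
Proof.
move=> C0; have e0 : 0 < (2 * 3 ^+ d)^-1 :> R by rewrite invr_gt0 mulr_gt0// exprn_gt0.
have level := prob_scale_le C0 e0; have level1 := prob_scale_le_pow2 C0; near=> k.
have k1 : (0 < k)%N by near: k; exact: nbhs_infty_gt.
have kr : 0 < k%:R :> R by rewrite ltr0n.
have -> : k.-1%:R / k%:R = 1 - k%:R^-1 :> R.
  by rewrite -subn1 natrB// mulrBl divff ?gt_eqF// mul1r.
rewrite lerD2l lerN2.
have : N k ^+ d * p (C * g (N k)) ^+ (2 * d) <= (2 * 3 ^+ d)^-1 * ln k%:R by near: k; exact: level.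
have p_half : p (C * g (N k)) <= 2^-1.
  apply: (@le_trans _ _ (2 ^- (3 * k))); first by near: k; exact: level1.
  by rewrite lef_pV2 ?posrE ?exprn_gt0// ler_eXnr ?muln_gt0 ?ler1n.
set a := p _ ^+ _ => small.
have a0 : 0 <= a by rewrite exprn_ge0.
have a_half : a <= 2^-1 by apply: le_trans p_half; rewrite ler_iXnr//; lia.
have side_le : ((2 * scale k + 1) ^ d)%:R <= 3 ^+ d * N k ^+ d :> R.
  by rewrite -exprMn natrX lerXn2r ?nnegrE ?mulr_ge0// -natrM ler_nat; have := scale_gt0 k; lia.
apply: (@le_trans _ _ (expR (- (2 * a)) ^+ ((2 * scale k + 1) ^ d))); last first.
  by rewrite lerXn2r ?nnegrE ?expR_ge0 ?expR_le_oneB// subr_ge0 (le_trans a_half)//; lra.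
rewrite -expRM_natl -[leLHS]lnK ?posrE ?invr_gt0// ler_expR lnV ?posrE// mulrN lerN2.
apply: le_trans (ler_wpM2r _ side_le) _; first by rewrite mulr_ge0.
by move: small; rewrite ler_pdivlMl ?mulr_gt0 ?exprn_gt0//; lra.
Unshelve. all: by end_near. Qed.

End AlmostDecreasing.
End ScaleBounds.

(** * The eigenvalue at a good scale *)

Lemma exists_first_good (R : realDomainType) (bad : pred nat) (h : nat -> R) (a b : nat) :
  (a <= b)%N -> ~~ bad b -> (forall j, 0 <= h j) ->
  exists j, ~~ bad j /\ h j <= h a + \sum_(a <= i < b) h i.+1 * (bad i)%:R.
Proof.
move=> ab good_b h0.
have h_bad i : 0 <= h i.+1 * (bad i)%:R by rewrite mulr_ge0.
have exists_good : exists j, (a <= j)%N && ~~ bad j by exists b; rewrite ab.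
case: (ex_minnP exists_good) => j /andP[aj good_j] j_min; exists j; split=> //.
have jb : (j <= b)%N by rewrite j_min// ab.
move: aj; rewrite leq_eqVlt => /predU1P[->|aj]; first by rewrite lerDl sumr_ge0.
rewrite ler_wpDl//; case: j aj jb {good_j} j_min => // j aj jb j_min.
have bad_j : bad j.
  by apply: contraT => good_j; have := j_min j; rewrite good_j -ltnS aj ltnn => /(_ isT).
rewrite (big_cat_nat (n := j))//= ?(big_ltn jb) 1?ltnW// bad_j mulr1.
by rewrite ler_wpDl ?sumr_ge0// ler_wpDr ?sumr_ge0.
Qed.

Section GoodScale.
Variables (R : realType) (d : nat) (g : R -> R) (c u0 : R) (W : edge d -> R) (i : 'I_d).
Variables (m n j0 J : nat) (t : R).
Local Notation r := (2 * m)%N.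
Hypothesis d_ge2 : (2 <= d)%N.
Hypothesis g_gt0 : forall u, 0 < u -> 0 < g u.
Hypothesis c_gt0 : 0 < c.
Hypothesis g_decr : almost_decreasing c u0 (fun u => u ^+ 2 * g u).
Hypothesis W_gt0 : forall e, 0 < W e.
Hypothesis t_gt0 : 0 < t.
Hypotheses (dm : (2 * d < m)%N) (rn : (r < n)%N).
Hypotheses (u0j : u0 <= 2 ^+ j0) (jJ : (j0 <= J)%N) (Jn : 2 ^+ J <= n%:R :> R).

Let bad j y := (m <= nbad r (slow W (g (2 ^+ j))) y)%N.

Hypothesis untrapped : forall x, inbox n x -> ~~ trapped (slow W t) x.
Hypothesis few_bad : forall y, inbox (2 * n) y -> (nbad r (slow W t) y <= 2 * d)%N.
Hypothesis top_good : forall y, inbox (2 * n) y -> ~~ bad J y.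
Hypothesis line_good : forall x j a, inbox n x -> (j0 <= j < J)%N -> (a < 2 * r + 1)%N ->
  (line_count r m (2 * n) a (slow W (g (2 ^+ j))) x i)%:R <= n%:R / 2 ^+ (3 * j) :> R.

Lemma line_bad_le x j : inbox n x -> (j0 <= j < J)%N ->
  \sum_(0 <= k < 2 * (2 * n) + 1) (bad j (line_pt (2 * n) x i k))%:R <=
  (2 * r + 1)%:R * (n%:R / 2 ^+ (3 * j)) :> R.
Proof.
move=> xn jj; have rp : (0 < 2 * r + 1)%N by rewrite addn1.
pose residue k := Ordinal (ltn_pmod k rp).
rewrite (partition_big residue xpredT)//= mulr_natl -[in leRHS](card_ord (2 * r + 1)) -sumr_const.
apply: ler_sum => a _; apply: le_trans (line_good xn jj (ltn_ord a)).
rewrite /line_count count_filter -natr_sum ler_nat -sum1_count /index_iota subn0.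
rewrite big_mkcond [leqRHS]big_mkcond/=; apply: leq_sum => k _.
by rewrite /bad -val_eqE/=; case: eqP; case: (m <= _)%N.
Qed.

Definition line_sum_bound : R :=
  5 * n%:R / g (2 ^+ j0) + 8 * (2 * r + 1)%:R / (c * 2 ^+ j0) / (n%:R * g n%:R).

Let n_gt0 : 0 < n%:R :> R.
Proof. by rewrite ltr0n (leq_trans _ rn). Qed.

Let g_pow_gt0 j : 0 < g (2 ^+ j).
Proof. by rewrite g_gt0 ?exprn_gt0. Qed.

Let gn_gt0 : 0 < g n%:R.
Proof. exact: g_gt0. Qed.

Lemma inv_speed_pow_le j : (j0 <= j < J)%N ->
  (g (2 ^+ j.+1))^-1 <= 4 * (2 ^+ j) ^+ 2 / (c * (n%:R ^+ 2 * g n%:R)).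
Proof.
move=> /andP[j0j jJ'].
have jn : 2 ^+ j.+1 <= n%:R :> R by apply: le_trans Jn; rewrite ler_eXn2l ?ltr1n.
have uj : u0 <= 2 ^+ j.+1.
  by apply: le_trans u0j _; rewrite ler_eXn2l ?ltr1n// ltnW.
rewrite ler_pdivlMr ?mulr_gt0 ?exprn_gt0// ler_pdivrMl//.
by apply: le_trans (g_decr uj jn) _; rewrite le_eqVlt (exprS _ j); apply/predU1P; left; ring.
Qed.

Lemma line_sum_le (Z : pt d -> R) x : inbox n x ->
  (forall y, inbox (2 * n) y ->
     (Z y)^-1 <= (g (2 ^+ j0))^-1 + \sum_(j0 <= j < J) (g (2 ^+ j.+1))^-1 * (bad j y)%:R) ->
  \sum_(0 <= k < 2 * (2 * n) + 1) (Z (line_pt (2 * n) x i k))^-1 <= line_sum_bound.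
Proof.
move=> xn ZV_le.
have lines_in k : (k < 2 * (2 * n) + 1)%N -> inbox (2 * n) (line_pt (2 * n) x i k).
  by apply: inbox_line_pt; apply: inboxW xn; rewrite leq_pmull.
rewrite big_nat; apply: le_trans (ler_sum _ (fun k kn => ZV_le _ (lines_in k _))) _ => //.
rewrite -big_nat big_split/= sumr_const_nat subn0 exchange_big/=; apply: lerD.
  rewrite -[leLHS]mulr_natl ler_wpM2r ?invr_ge0 ?(ltW (g_pow_gt0 j0))//.
  by rewrite -natrM ler_nat; move: rn; clear; lia.
set D : R := (2 * r + 1)%:R.
have term_le j : (j0 <= j < J)%N ->
    \sum_(0 <= k < 2 * (2 * n) + 1) (g (2 ^+ j.+1))^-1 * (bad j (line_pt (2 * n) x i k))%:R <=
    4 * D / (c * (n%:R * g n%:R)) * 2 ^- j.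
  move=> jj; rewrite -mulr_sumr.
  apply: le_trans (ler_pM _ _ (inv_speed_pow_le jj) (line_bad_le xn jj)) _.
  - by rewrite invr_ge0 ltW.
  - by rewrite sumr_ge0.
  rewrite -/D (mulnC 3) exprM le_eqVlt; apply/predU1P; left.
  by field; rewrite !gt_eqF ?exprn_gt0.
rewrite big_nat; apply: le_trans (ler_sum _ term_le) _.
rewrite -big_nat -mulr_sumr.
have const_ge0 : 0 <= 4 * D / (c * (n%:R * g n%:R)).
  by rewrite divr_ge0 ?mulr_ge0 ?ler0n// ltW.
apply: le_trans (ler_wpM2l const_ge0 (sum_pow2V_le R j0 J)) _.
rewrite le_eqVlt; apply/predU1P; left.
by field; rewrite !gt_eqF ?exprn_gt0.
Qed.

Lemma good_scale_poincare f : (forall x, ~ inbox n x -> f x = 0) ->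
  \sum_(x <- box n) f x ^+ 2 <=
  (poincare_const d r)%:R * (t^-1 + n%:R * line_sum_bound) * local_energy W f n.+1 0.
Proof.
move=> f_supp.
have /choice[lev levP] y : exists j, inbox (2 * n) y -> ~~ bad j y /\
    (g (2 ^+ j))^-1 <=
    (g (2 ^+ j0))^-1 + \sum_(j0 <= i < J) (g (2 ^+ i.+1))^-1 * (bad i y)%:R.
  have [yn|] := pselect (inbox (2 * n) y); last by exists 0%N.
  have gV_ge0 j : 0 <= (g (2 ^+ j))^-1 by rewrite invr_ge0 ltW.
  by have [j first_j] := exists_first_good (bad := bad^~ y) jJ (top_good yn) gV_ge0; exists j.
apply: (@weighted_poincare _ _ W n r m t _ (fun y => g (2 ^+ lev y)) i) => //.
- by move=> e; exact: ltW.
- by move=> y yn; have [good_y _] := levP y yn; rewrite ltnNge.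
- move=> x xn; apply: (@line_sum_le (fun y => g (2 ^+ lev y))) => // y yn.
  by have [] := levP y yn.
Qed.

Lemma good_scale_lambda1_ge :
  (2 * ((poincare_const d r)%:R * (t^-1 + n%:R * line_sum_bound)))^-1 <= lambda1 W n.
Proof.
have bound_ge0 : 0 <= line_sum_bound.
  by rewrite addr_ge0// !divr_ge0 ?mulr_ge0 ?exprn_ge0 ?ler0n// ltW.
apply: lambda1_ge => [e||f]; [exact: ltW| |exact: good_scale_poincare].
rewrite mulr_gt0 ?ltr0n ?poincare_const_gt0//.
by rewrite ltr_wpDr ?invr_gt0 ?mulr_ge0 ?(ltW n_gt0).
Qed.

Lemma good_scale_ratio_ge (tau e : R) : 0 < tau ->
  6 * (poincare_const d r)%:R * tau * e <= 1 -> g n%:R / t <= e ->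
  5 * (n%:R ^+ 2 * g n%:R) / g (2 ^+ j0) <= e -> 8 * (2 * r + 1)%:R / (c * 2 ^+ j0) <= e ->
  tau <= lambda1 W n / g n%:R.
Proof.
move=> tau0 Ke first_le second_le third_le; set K := (poincare_const d r)%:R in Ke.
have K0 : 0 < K by rewrite ltr0n poincare_const_gt0.
have scaled_le : g n%:R * (t^-1 + n%:R * line_sum_bound) <= 3 * e.
  have -> : g n%:R * (t^-1 + n%:R * line_sum_bound) = g n%:R / t +
      5 * (n%:R ^+ 2 * g n%:R) / g (2 ^+ j0) + 8 * (2 * r + 1)%:R / (c * 2 ^+ j0).
    by rewrite /line_sum_bound; field; rewrite !gt_eqF ?exprn_gt0.
  by lra.
rewrite ler_pdivlMr//; apply: le_trans good_scale_lambda1_ge; rewrite -/K.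
set X := _ + _ in scaled_le *; have X0 : 0 < X.
  rewrite ltr_wpDr ?invr_gt0 ?mulr_ge0 ?(ltW n_gt0)//.
  by rewrite addr_ge0// !divr_ge0 ?mulr_ge0 ?exprn_ge0 ?ler0n// ltW.
rewrite -[leRHS]div1r ler_pdivlMr ?mulr_gt0//.
have -> : tau * g n%:R * (2 * (K * X)) = 2 * K * tau * (g n%:R * X) by ring.
apply: le_trans (ler_wpM2l _ scaled_le) _; first by rewrite !mulr_ge0 ?ltW.
by lra.
Qed.

End GoodScale.

(** * Almost sure behaviour along the scales *)

Section AlmostSureScales.
Variables (R : realType) (dd : measure_display) (T : measurableType dd).
Variables (P : probability T R) (d : nat) (w : edge d -> T -> R) (e0 : edge d) (i : 'I_d).
Variables (g : R -> R) (c u0 : R).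
Local Notation p := (edge_cdf P w e0).
Local Notation N k := ((scale k)%:R : R).
Hypothesis d_ge2 : (2 <= d)%N.
Hypothesis iid : iid_env P w.
Hypothesis g_gt0 : forall u, 0 < u -> 0 < g u.
Hypothesis c_gt0 : 0 < c.
Hypothesis u0_gt0 : 0 < u0.
Hypothesis g_decr : almost_decreasing c u0 (fun u => u ^+ 2 * g u).
Hypothesis p_small : forall e, 0 < e ->
  \forall u \near +oo, u ^+ d * p (g u) ^+ (2 * d) <= e * ln (ln u).
Hypothesis g_cvg0 : u ^+ 2 * g u @[u --> +oo] --> 0.

Let p01 := edge_cdf01 e0 iid.
Let p_mono := le_edge_cdf e0 iid.

Lemma ae_inner_untrapped (C : R) : 0 < C -> {ae P, forall om, \forall k \near \oo,
  ~ has (trapped (slow (w^~ om) (C * g (N k)))) (box (scale k.-1).+1)}.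
Proof.
move=> C0; apply: ae_eventually_not (fun k => prob_trapped_box_le e0 iid _ _) _.
exact: (inner_trapped_bound d_ge2 p01 p_small p_mono g_gt0 c_gt0 u0_gt0 g_decr).
Qed.

Lemma ae_not_crowded_ball (C : R) (r : nat) : 0 < C -> {ae P, forall om, \forall k \near \oo,
  ~ crowded_ball r (2 * d).+1 (2 * scale k) (slow (w^~ om) (C * g (N k)))}.
Proof.
move=> C0; apply: ae_eventually_not (fun k => prob_crowded_ball_le e0 iid _ _ _ _) _.
exact: (crowded_ball_bound d_ge2 p01 p_small p_mono g_gt0 c_gt0 u0_gt0 g_decr).
Qed.

Lemma ae_not_crowded_ball_dyadic (r h : nat) : (4 * d + 4 <= h)%N ->
  {ae P, forall om, \forall k \near \oo,
    ~ crowded_ball r (2 * d * h) (2 * scale k) (slow (w^~ om) (g (2 ^+ (k ^ 2))))}.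
Proof.
move=> dh; apply: ae_eventually_not (fun k => prob_crowded_ball_le e0 iid _ _ _ _) _.
exact: (crowded_ball_dyadic_bound d_ge2 p01).
Qed.

Lemma ae_not_crowded_line (r m j0 : nat) :
  (forall j, (j0 <= j)%N -> forall k, (j < k ^ 2)%N ->
     (1 + 2 ^+ ball_card d r * p (g (2 ^+ j)) ^+ m) ^+ (2 * (2 * scale k) + 1) <=
     2 ^+ (2 ^ line_exponent k j)) ->
  {ae P, forall om, \forall k \near \oo, forall j, (j0 <= j < k ^ 2)%N ->
    ~ crowded_line r m (2 * scale k) (2 * 2 ^ line_exponent k j) i (slow (w^~ om) (g (2 ^+ j)))}.
Proof.
move=> moment.
pose F k j := [set om | crowded_line r m (2 * scale k) (2 * 2 ^ line_exponent k j) i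
  (slow (w^~ om) (g (2 ^+ j)))].
have line_le k j : j \in index_iota j0 (k ^ 2) -> measurable (F k j) /\
    (P (F k j) <= (((2 * (2 * scale k) + 1) ^ d * (2 * r + 1))%:R /
      2 ^+ (2 ^ line_exponent k j))%:E)%E.
  rewrite mem_index_iota => /andP[j0j jk].
  by apply: prob_crowded_line_le => //; exact: moment.
have := ae_eventually_not (fun k => prob_bigcup_seq_le (line_le k)) (crowded_line_bound _ _ _ _).
apply: filterS => om; apply: filterS => k not_F j jj crowded_j.
by apply: not_F; exists j => //=; rewrite mem_index_iota.
Qed.

Lemma ae_frequently_untrapped (C : R) : 0 < C -> {ae P, forall om, forall a,
  exists2 k, (a <= k)%N & ~ has (trapped (slow (w^~ om) (C * g (N k)))) (block d scale k)}.
Proof.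
move=> C0.
have [k0 _ bound] := annulus_trapped_bound d_ge2 p01 p_small p_mono g_gt0 c_gt0 u0_gt0 g_decr C0.
pose V k := [set om | has (trapped (slow (w^~ om) (C * g (N k)))) (block d scale k)].
apply: (@ae_frequently_not _ _ _ P V (maxn 2 k0) (fun a m => a.-1%:R / (a.-1 + m)%:R)) => [a m|a].
  rewrite geq_max => /andP[a2 k0a].
  have [mV PV] := prob_trapped_blocks_le e0 iid (fun k => C * g (N k)) leq_scale a m.
  have -> : [set om | forall k, k \in iota a m -> V k om] = [set om | all (fun k =>
      has (trapped (slow (w^~ om) (C * g (N k)))) (block d scale k)) (iota a m)].
    by apply/funext => om; apply/propext; split=> /allP.
  split=> //; apply: le_trans PV _; rewrite lee_fin -prod_pred_div ?prednK//; try lia.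
  rewrite big_seq [leRHS]big_seq; apply: ler_prod => k; rewrite mem_iota => /andP[ak _].
  rewrite bound ?andbT/=; last exact: leq_trans ak.
  have /andP[q0 q1] := p01 (C * g (N k)).
  by rewrite subr_ge0 exprn_ile1// ?subr_ge0 ?exprn_ile1// lerBlDr lerDl exprn_ge0.
rewrite -(mulr0 a.-1%:R); apply: cvgM (cvg_cst _) _.
apply/gtr0_cvgV0; first by exists 1%N => // m /= m1; rewrite ltr0n; lia.
by apply/cvgrnyP; exact: cvg_addnl.
Qed.

(* By prob_dyadic_le, p (g (2 ^ j)) ^ m <= 2 ^ - (j h): at the top level     *)
(* j = k ^ 2 this beats the number of vertices, of order 2 ^ (4 k ^ 2 d).    *)
Let h := (4 * d + 4)%N.
Let m := (2 * d * h)%N.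
Let r := (2 * m)%N.

Lemma exists_base_level (e : R) : 0 < e -> exists j0, [/\ u0 <= 2 ^+ j0,
  8 * (2 * r + 1)%:R / (c * 2 ^+ j0) <= e &
  forall j, (j0 <= j)%N -> forall k, (j < k ^ 2)%N ->
    (1 + 2 ^+ ball_card d r * p (g (2 ^+ j)) ^+ m) ^+ (2 * (2 * scale k) + 1) <=
    2 ^+ (2 ^ line_exponent k j)].
Proof.
move=> e_gt0; have h4 : (4 <= h)%N by exact: leq_addl.
have [j1 _ moment] := line_moment_le d_ge2 p01 p_small (ball_card d r) h4.
have /cvgryPge pow2_ge := @pow2_cvgy R.
have [j2 _ base] := filterI (pow2_ge u0) (pow2_ge (8 * (2 * r + 1)%:R / (c * e))).
have [u0_le D_le] := base (maxn j1 j2) (leq_maxr _ _).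
exists (maxn j1 j2); split=> // [|j]; last by rewrite geq_max => /andP[/moment].
move: D_le; rewrite !ler_pdivrMr ?mulr_gt0 ?exprn_gt0//.
by rewrite [c * e]mulrC mulrCA [2 ^+ _ * c]mulrC.
Qed.

Lemma near_scale_ratio_ge (W : edge d -> R) (C e tau : R) (j0 : nat) :
  (forall x, 0 < W x) -> 0 < C -> 0 < e -> 0 < tau -> C^-1 <= e ->
  6 * (poincare_const d r)%:R * tau * e <= 1 ->
  u0 <= 2 ^+ j0 -> 8 * (2 * r + 1)%:R / (c * 2 ^+ j0) <= e ->
  (\forall k \near \oo, ~ has (trapped (slow W (C * g (N k)))) (box (scale k.-1).+1)) ->
  (\forall k \near \oo, ~ crowded_ball r (2 * d).+1 (2 * scale k) (slow W (C * g (N k)))) ->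
  (\forall k \near \oo, ~ crowded_ball r m (2 * scale k) (slow W (g (2 ^+ (k ^ 2))))) ->
  (\forall k \near \oo, forall j, (j0 <= j < k ^ 2)%N ->
    ~ crowded_line r m (2 * scale k) (2 * 2 ^ line_exponent k j) i (slow W (g (2 ^+ j)))) ->
  \forall k \near \oo, ~ has (trapped (slow W (C * g (N k)))) (block d scale k) ->
    tau <= lambda1 W (scale k) / g (N k).
Proof.
move=> W_gt0 C0 e_gt0 tau0 Ce Ke u0j0 Dj0 inner few_bad few_slow lines.
have gj0 : 0 < g (2 ^+ j0) by rewrite g_gt0 ?exprn_gt0.
have q_small : \forall u \near +oo, u ^+ 2 * g u <= e / 5 * g (2 ^+ j0).
  by apply: cvgr_le g_cvg0 _ _; rewrite mulr_gt0 ?divr_gt0.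
have q_scale := @natr_scale_cvgy R _ q_small.
near=> k => block_untrapped.
have j0k : (j0 <= k)%N by near: k; exact: nbhs_infty_ge.
have rk : (r < k)%N by near: k; exact: nbhs_infty_gt.
have gN : 0 < g (N k) by rewrite g_gt0 ?ltr0n ?scale_gt0.
have jk : (j0 <= k ^ 2)%N by rewrite (leq_trans j0k)// -mulnn leq_pmull// (leq_ltn_trans _ rk).
have level_k : 2 ^+ (k ^ 2) <= N k by rewrite scaleE ler_eXn2l ?ltr1n// leq_pmull.
apply: (good_scale_ratio_ge (m := m) (i := i) (t := C * g (N k)) d_ge2 g_gt0 c_gt0 g_decr
  W_gt0 _ _ _ u0j0 jk level_k _ _ _ _ tau0 Ke _ _ Dj0).
- exact: mulr_gt0.
- by apply: ltn_Pmulr; [rewrite /h addn4|rewrite muln_gt0/= ltnW].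
- exact: leq_trans rk (leq_id_scale k).
- move=> x xn; apply/negP => trapped_x.
  have [/boxP x_in|/boxP x_out] := boolP (x \in box (scale k.-1).+1).
    have : ~ has (trapped (slow W (C * g (N k)))) (box (scale k.-1).+1) by near: k; exact: inner.
    by apply; apply/hasP; exists x => //; apply/boxP.
  by apply: block_untrapped; apply/hasP; exists x => //; apply/annulusP; split.
- by move=> y; rewrite -ltnS; apply: not_crowded_ball; near: k; exact: few_bad.
- by move=> y; rewrite -ltnNge; apply: not_crowded_ball; near: k; exact: few_slow.
- move=> x j a xn jj ar; have /andP[_ jk2] := jj; rewrite -line_exponentE// ler_nat.
  apply: not_crowded_line ar; last by apply: inboxW xn; rewrite leq_pmull.
  by move: j jj {jk2}; near: k; exact: lines.
- by rewrite invfM mulrCA divff ?mulr1// gt_eqF.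
- rewrite ler_pdivrMr// -ler_pdivlMl// mulrA [5^-1 * e]mulrC.
  by near: k; exact: q_scale.
Unshelve. all: by end_near. Qed.

(* In e = 1 / (6 K tau), a factor 2 is lost in lambda1_ge and a factor 3     *)
(* accounts for the three terms of the Poincare constant.                    *)
Lemma ae_lambda1_frequently_ge (tau : R) : 0 < tau ->
  {ae P, forall om, forall a, exists2 n, (a <= n)%N & tau <= lambda1 (w^~ om) n / g n%:R}.
Proof.
move=> tau0; have [_ w_gt0 _ _] := iid.
pose K : R := (poincare_const d r)%:R; pose e := (6 * K * tau)^-1; pose C := e^-1.
have Kt0 : 0 < 6 * K * tau by rewrite !mulr_gt0// ltr0n poincare_const_gt0.
have e_gt0 : 0 < e by rewrite invr_gt0.
have C0 : 0 < C by rewrite invr_gt0.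
have [j0 [u0j0 Dj0 moment]] := exists_base_level e_gt0.
have [inner_ae often_ae] := (ae_inner_untrapped C0, ae_frequently_untrapped C0).
have few_bad_ae := ae_not_crowded_ball r C0.
have few_slow_ae := ae_not_crowded_ball_dyadic r (leqnn h).
have lines_ae := ae_not_crowded_line moment.
apply: filterS (filterI (filterI (filterI few_bad_ae few_slow_ae)
  (filterI inner_ae often_ae)) lines_ae).
move=> om [[[few_bad few_slow] [inner often]] lines] a.
have [||k0 _ good_k] := near_scale_ratio_ge (w_gt0^~ om) C0 e_gt0 tau0 _ _ u0j0 Dj0
  inner few_bad few_slow lines.
- by rewrite invrK.
- by rewrite divff// gt_eqF.
have [k] := often (maxn a k0); rewrite geq_max => /andP[ak k0k] untrapped.
by exists (scale k); [exact: leq_trans ak (leq_id_scale k)|exact: good_k].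
Qed.

End AlmostSureScales.

Lemma limn_esup_pinfty (R : realType) (u : nat -> R) :
  (forall (M a : nat), exists2 n, (a <= n)%N & M%:R <= u n) ->
  limn_esup (fun n => (u n)%:E) = +oo%E.
Proof.
move=> unbounded; apply/eqP; rewrite -leye_eq; apply: le_ereal_inf_tmp => _ [A [a _ Aa] <-].
rewrite leye_eq; apply/eqP/eqyP => M M0.
have [n an un] := unbounded (Num.truncn M).+1 a.
apply: (@le_trans _ _ (u n)%:E).
  by rewrite lee_fin (le_trans _ un)// ltW// truncnS_gt.
by apply: ereal_sup_ubound; exists n => //; exact: Aa.
Qed.

Lemma near_le_of_ratio_cvg0 (R : realType) (h : R -> R) :
  h u / ln (ln u) @[u --> +oo] --> (0 : R) ->
  forall e, 0 < e -> \forall u \near +oo, h u <= e * ln (ln u).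
Proof.
move=> h_small e e0; have ratio_le := cvgr_le _ h_small e e0; near=> u.
have lnlnu : 0 < ln (ln u).
  have : expR 2 <= u by near: u; apply: nbhs_pinfty_ge; rewrite num_real.
  move=> u2; have up : 0 < u by apply: lt_le_trans u2; exact: expR_gt0.
  by rewrite ln_gt0// (@lt_le_trans _ _ 2) ?ltr1n// -[leLHS](expRK 2) ler_ln ?posrE ?expR_gt0.
by rewrite -ler_pdivrMr//; near: u; exact: ratio_le.
Unshelve. all: by end_near. Qed.

Theorem theorem1p1 (R : realType) (dd : measure_display) (T : measurableType dd)
    (P : probability T R) (d : nat) (w : edge d -> T -> R) (g : R -> R)
    (d2 : (2 <= d)%N) :
  iid_env P w ->
  (forall u, 0 < u -> 0 < g u) ->
  mono_to_zero g ->
  ((exists rho : R, rho < -2 /\ reg_var g rho) \/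
   mono_to_zero (fun u => u ^+ 2 * g u)) ->
  (Lambda P w (Ordinal (leq_trans (isT : (0 < 2)%N) d2)) g u / ln (ln u))
      @[u --> +oo] --> (0 : R) ->
  {ae P, forall om,
     limn_esup (fun n : nat => ((lambda1 (w ^~ om) n) / g n%:R)%:E) = +oo%E}.
Proof.
move=> iid g_gt0 [g_mono _] growth Lambda_cvg0.
have [c [u0 [c_gt0 u0_gt0 g_decr q_cvg0]]] := speed_decay g_gt0 g_mono growth.
set i := Ordinal _ in Lambda_cvg0; have Lambda_small := near_le_of_ratio_cvg0 Lambda_cvg0.
have large M := ae_lambda1_frequently_ge i d2 iid g_gt0 c_gt0 u0_gt0 g_decr Lambda_small q_cvg0
  (ltr0Sn R M).
apply: filterS (ae_foralln large) => om freq; apply: limn_esup_pinfty => M a.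
by have [n an Mn] := freq M a; exists n => //; apply: le_trans Mn; rewrite ler_nat.
Qed.
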